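(* Let $p\in\mathbb{R}\langle x,x^T\rangle$ be a symmetric nc polynomial that is nc plurisubharmonic on an nc open set $\mathcal{G}$. Then the nc complex hessian $q$ of $p$ can be written as $$q(x,x^T)[h,h^T] = V(x,x^T)[h,h^T]^T\, L(x,x^T)\, D\, L(x,x^T)^T\, V(x,x^T)[h,h^T],$$ where $V(x,x^T)[h,h^T]$ is a (border) vector of monomials in $x,x^T,h,h^T$, each entry having the form $h_j m(x,x^T)$ or $h_j^T m(x,x^T)$ with $m$ a monomial in $x,x^T$; $D=\mathrm{diag}(d_1,d_2,\ldots,d_{\mathcal{N}})$ is a positive semidefinite constant real matrix (i.e. each $d_i$ is a nonnegative real number); and $L(x,x^T)$ is a unit lower triangular matrix (lower triangular with ones on the diagonal) whose entries are nc polynomials in $x,x^T$.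
   Context: Let $x=(x_1,\dots,x_g)$, $x^T=(x_1^T,\dots,x_g^T)$ be $2g$ noncommuting formal variables and $\mathbb{R}\langle x,x^T\rangle$ the free algebra of nc (noncommutative) polynomials in them, with the involution $^T$ that reverses products and exchanges $x_j$ and $x_j^T$. Let $h=(h_1,\dots,h_g)$, $h^T=(h_1^T,\dots,h_g^T)$ be $2g$ further noncommuting variables, with the involution extended in the same way. The transpose of a vector or matrix of nc polynomials is the usual transpose with the involution applied to each entry. An nc polynomial $p$ is symmetric if $p^T=p$. For $X\in(\mathbb{R}^{n\times n})^g$, $p(X,X^T)$ is obtained by replacing $x_j$ by $X_j$ and $x_j^T$ by the matrix transpose $X_j^T$. The nc complex hessian of $p$ is the nc polynomial in $x,x^T,h,h^T$ $$q(x,x^T)[h,h^T]:=\frac{\partial^2 p}{\partial s\,\partial t}(x+th,\,y+sk)\Big|_{t=s=0}\Big|_{y=x^T,\,k=h^T},$$ where first every $x_i^T$ in $p$ is replaced by a formal variable $y_i$. A nonempty set $\mathcal{G}\subseteq\bigcup_{n\ge1}(\mathbb{R}^{n\times n})^g$, with $\mathcal{G}_n:=\mathcal{G}\cap(\mathbb{R}^{n\times n})^g$, is an nc open set if (i) it respects direct sums: for every finite list $X^1\in\mathcal{G}_{n_1},\dots,X^t\in\mathcal{G}_{n_t}$ (repetitions allowed) the componentwise block-diagonal direct sum $\bigoplus_j X^j$ lies in $\mathcal{G}_{n_1+\cdots+n_t}$; and (ii) there is a positive integer $n_0$ such that $\mathcal{G}_n$ is open for all $n>n_0$. A symmetric $p$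 is nc plurisubharmonic (nc plush) on $\mathcal{G}$ if $q(X,X^T)[H,H^T]\succeq0$ for all $n\ge1$, all $X\in\mathcal{G}_n$ and all $H\in(\mathbb{R}^{n\times n})^g$. *)

(* Defs.v *)
From HB Require Import structures.
From mathcomp Require Import all_boot all_order all_algebra.
From mathcomp Require Import finmap monalg.
From mathcomp Require Import boolp classical_sets reals topology normedtype.

Set Implicit Arguments.
Unset Strict Implicit.
Unset Printing Implicit Defensive.

Import Order.TTheory GRing.Theory Num.Theory.
Import numFieldNormedType.Exports.

Local Open Scope ring_scope.
Local Open Scope classical_set_scope.

(* Free algebra over R on the alphabet A: [{fmonom A}] is the free monoid of
   words, [<< c *g w >>] the term c w, [p@_w] the coefficient of w in p. *)
Notation ncpoly R A := {malg R[{fmonom A}]}.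

(* [inl j] is x_j and [inr j] is x_j^T; in the free algebra these are
   unrelated letters. *)
Notation xvar g := ('I_g + 'I_g)%type.

(* [inl a] is the letter a itself; [inr a] is its direction, i.e.
   [inr (inl j)] is h_j and [inr (inr j)] is h_j^T. *)
Notation xhvar g := (xvar g + xvar g)%type.

Section Involution.
Variables (R : realType) (A : choiceType) (s : A -> A).

Definition word_tr (w : {fmonom A}) : {fmonom A} := FMonom (rev (map s w)).

(* The linear extension of w |-> word_tr w; s is the involution on letters. *)
Definition nc_tr (p : ncpoly R A) : ncpoly R A :=
  \sum_(w <- msupp p) << p@_w *g word_tr w >>.

Definition ncmx_tr m n (M : 'M[ncpoly R A]_(m, n)) : 'M[ncpoly R A]_(n, m) :=
  map_mx nc_tr M^T.

End Involution.

Definition xvar_tr g (a : xvar g) : xvar g :=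
  match a with inl j => inr j | inr j => inl j end.

Definition xhvar_tr g (a : xhvar g) : xhvar g :=
  match a with inl b => inl (xvar_tr b) | inr b => inr (xvar_tr b) end.

Definition nc_symmetric (R : realType) g (p : ncpoly R (xvar g)) : Prop :=
  nc_tr (@xvar_tr g) p = p.

Section Hessian.
Variables (R : realType) (g : nat).

Definition var (A : choiceType) (a : A) : ncpoly R A := << fmu a >>.

Definition word_incl (w : {fmonom (xvar g)}) : {fmonom (xhvar g)} :=
  FMonom (map inl w).

(* The inclusion of R<x,x^T> into R<x,x^T,h,h^T>. *)
Definition nc_incl (p : ncpoly R (xvar g)) : ncpoly R (xhvar g) :=
  \sum_(w <- msupp p) << p@_w *g word_incl w >>.

(* Polynomials in the two central real variables t (inner) and s (outer) with
   coefficients in R<x,y,h,k>; since x_j^T is a letter independent of x_j,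
   y = x^T and k = h^T are not given separate names. *)
Let polyst := {poly {poly ncpoly R (xhvar g)}}.
Let tvar : polyst := 'X%:P.
Let svar : polyst := 'X.

Definition perturb (a : xvar g) : polyst :=
  match a with
  | inl j => (var (inl (inl j)))%:P%:P + tvar * (var (inr (inl j)))%:P%:P
  | inr j => (var (inl (inr j)))%:P%:P + svar * (var (inr (inr j)))%:P%:P
  end.

(* p(x + th, y + sk) *)
Definition nc_perturb (p : ncpoly R (xvar g)) : polyst :=
  mmap (fun c : R => (c%:MP)%:P%:P)
       (fun w : {fmonom (xvar g)} => \prod_(a <- w) perturb a) p.

(* [map_poly deriv] is d/dt and the outer derivative is d/ds; the two
   evaluations set s = 0, then t = 0. *)
Definition complex_hessian (p : ncpoly R (xvar g)) : ncpoly R (xhvar g) :=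
  ((map_poly (fun u => u^`()) (nc_perturb p))^`()).[0].[0].

End Hessian.

Section Evaluation.
Variables (R : realType) (g n : nat).

Definition nc_eval (A : choiceType) (v : A -> 'M[R]_n) (p : ncpoly R A) :
  'M[R]_n := \sum_(w <- msupp p) p@_w *: \prod_(a <- w) v a.

Definition xval (X : 'I_g -> 'M[R]_n) (a : xvar g) : 'M[R]_n :=
  match a with inl j => X j | inr j => (X j)^T end.

Definition xhval (X H : 'I_g -> 'M[R]_n) (a : xhvar g) : 'M[R]_n :=
  match a with inl b => xval X b | inr b => xval H b end.

Definition psd (M : 'M[R]_n) : Prop :=
  M^T = M /\ forall v : 'cV[R]_n, 0 <= (v^T *m M *m v) 0 0.

End Evaluation.

(* A graded set of g-tuples of square matrices. Only the levels n >= 1 are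
   meaningful: everything below ignores the level 0. *)
Notation ncset R g := (forall n : nat, set {ptws 'I_g -> 'M[R]_n}).

Definition nc_open_set (R : realType) g (G : ncset R g) : Prop :=
  [/\ exists2 n, (0 < n)%N & G n !=set0,
      forall (t : nat) (n : 'I_t -> nat)
             (X : forall i : 'I_t, 'I_g -> 'M[R]_(n i)),
        (0 < t)%N -> (forall i, 0 < n i)%N -> (forall i, G (n i) (X i)) ->
        G (\sum_i n i)%N (fun j => \mxdiag_i X i j)
    & exists2 n0 : nat, (0 < n0)%N & forall n, (n0 < n)%N -> open (G n)].

Definition nc_plush (R : realType) g (G : ncset R g) (p : ncpoly R (xvar g)) :
  Prop :=
  forall n : nat, (0 < n)%N -> forall X, G n X -> forall H : 'I_g -> 'M[R]_n,
    psd (nc_eval (xhval X H) (complex_hessian p)).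

(* Each entry is h_j m or h_j^T m for a monomial m in x, x^T. *)
Definition border_vector (R : realType) g N
    (V : 'cV[ncpoly R (xhvar g)]_N) : Prop :=
  forall i, exists (j : 'I_g) (m : {fmonom (xvar g)}),
    V i 0 = var R (inr (inl j)) * << word_incl m >> \/
    V i 0 = var R (inr (inr j)) * << word_incl m >>.

Definition unit_lower_triangular (R : realType) g N
    (L : 'M[ncpoly R (xvar g)]_N) : Prop :=
  is_trig_mx L /\ forall i, L i i = 1.

(* Main.v *)
(* Let q be the complex hessian.  Evaluate q at X (+) Y on the vector (v, 0),
   where the vectors w(X) v, for words w of bounded length, are linearly
   independent, in a direction mapping the summand of X to that of Y.  The
   directional factors then take arbitrary values, and one of the two halves of
   q disappears: for either type of letters (x_j or x_j^T), and for every Y in G,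
     sum_w p_w sum_(w = w1 u w2) <y(w1^T), u(Y) y(w2)> >= 0
   for all vectors y(w), where w ranges over the words starting with a letter of
   that type.

   A descending induction on the length of a shows that p has no word
   a^T u b with a and b starting with letters of one type and a containing a
   letter of the other: the induction hypothesis kills the diagonal coefficients
   a^T u a, hence by positivity the whole row of a.  So every word of p on which
   the hessian does not vanish is c^T d with c and d both analytic or both
   antianalytic, and q = sum P_(c,d) (c')^T d', where w' is the first order
   derivative of w and P_(c,d) the coefficient of c^T d in p.  The constant matrix P
   is positive semidefinite, so P = L0 D L0^T.  Finally d' = sum c m, over the
   factorizations d = c e with e nonempty, where m is the border monomial
   obtained from e by turning its first letter into its direction; the matrix
   of this expansion is unit triangular when the words are sorted by decreasing
   length. *)
Require Import Defs.
From HB Require Import structures.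
From mathcomp Require Import all_boot all_order all_algebra.
From mathcomp Require Import finmap monalg.
From mathcomp Require Import boolp classical_sets reals topology normedtype.
From mathcomp Require Import zify ring lra.

Import Order.TTheory GRing.Theory Num.Theory.
Import numFieldNormedType.Exports.

Local Open Scope ring_scope.

Set Implicit Arguments.
Unset Strict Implicit.
Unset Printing Implicit Defensive.

(** * Words and their evaluation *)

Section WordEvaluation.
Variables (R : realType) (n : nat) (A : Type) (v : A -> 'M[R]_n).

Definition wev (w : seq A) : 'M[R]_n := \prod_(a <- w) v a.

Lemma wev_nil : wev [::] = 1%:M.
Proof. by rewrite /wev big_nil. Qed.

Lemma wev_cons a w : wev (a :: w) = v a *m wev w.
Proof. by rewrite /wev big_cons. Qed.

Lemma wev_cat w1 w2 : wev (w1 ++ w2) = wev w1 *m wev w2.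
Proof. by rewrite /wev big_cat. Qed.

End WordEvaluation.

Definition wtr g (w : seq (xvar g)) : seq (xvar g) := rev (map (@xvar_tr g) w).

Lemma xvar_trK g : involutive (@xvar_tr g).
Proof. by case. Qed.

Lemma xvar_tr_type g (a : xvar g) : is_inl (xvar_tr a) = ~~ is_inl a.
Proof. by case: a. Qed.

Lemma wtrK g : involutive (@wtr g).
Proof. by move=> w; rewrite /wtr map_rev revK mapK //; exact: xvar_trK. Qed.

Lemma wtr_cat g (u w : seq (xvar g)) : wtr (u ++ w) = wtr w ++ wtr u.
Proof. by rewrite /wtr map_cat rev_cat. Qed.

Lemma wtr_cons g (a : xvar g) w : wtr (a :: w) = wtr w ++ [:: xvar_tr a].
Proof. by rewrite /wtr /= rev_cons -cats1. Qed.

Lemma wtr1 g (a : xvar g) : wtr [:: a] = [:: xvar_tr a].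
Proof. by rewrite wtr_cons. Qed.

Lemma size_wtr g (w : seq (xvar g)) : size (wtr w) = size w.
Proof. by rewrite /wtr size_rev size_map. Qed.

Lemma xval_tr (R : realType) g n (X : 'I_g -> 'M[R]_n) a :
  xval X (xvar_tr a) = (xval X a)^T.
Proof. by case: a => j //=; rewrite trmxK. Qed.

Lemma wev_wtr (R : realType) g n (X : 'I_g -> 'M[R]_n) w :
  wev (xval X) (wtr w) = (wev (xval X) w)^T.
Proof.
elim: w => [|a w IHw]; first by rewrite wev_nil trmx1.
by rewrite wtr_cons wev_cat wev_cons wev_cons wev_nil mulmx1 IHw xval_tr trmx_mul.
Qed.

(** * A tuple with a linearly independent orbit on the truncated Fock space *)

Section Fock.
Variables (R : realType) (g D n : nat).
Let I : finType := D.-bseq (xvar g).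

(** Row-freeness expresses that the vectors w(X) v, for words w of length at most D, are linearly
    independent. *)
Definition orbit_mx (X : 'I_g -> 'M[R]_n) (v : 'cV[R]_n) : 'M[R]_(#|I|, n) :=
  \matrix_(i, k) (wev (xval X) (enum_val i : I) *m v) k 0.

Hypothesis In : (#|I| <= n)%N.

Let io (u : I) : 'I_n := widen_ord In (enum_rank u).

Let io_inj : injective io.
Proof. by move=> u w /(congr1 val) /= /val_inj /enum_rank_inj. Qed.

(* The creation operator of the letter a on the truncated full Fock space. *)
Let creat (a : xvar g) : 'M[R]_n := \matrix_(k, l)
  [exists u : I, exists w : I,
     [&& u == a :: w :> seq _, k == io u & l == io w]]%:R.

Let creatE a (u w : I) : creat a (io u) (io w) = (u == a :: w :> seq _)%:R.
Proof.
rewrite mxE; congr (_ %:R); congr nat_of_bool; apply/existsP/idP.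
  by case=> u' /existsP[w' /and3P[/eqP e /eqP/io_inj-> /eqP/io_inj->]]; rewrite e.
by move=> e; exists u; apply/existsP; exists w; rewrite e !eqxx.
Qed.

Let creat_row a (u : I) l :
  creat a (io u) l != 0 -> exists2 w : I, u = a :: w :> seq _ & l = io w.
Proof.
rewrite mxE; case: existsP => [[u' /existsP[w /and3P[/eqP e /eqP/io_inj-> /eqP->]]] _|].
  by exists w.
by rewrite eqxx.
Qed.

Let creat_col a k (w : I) :
  creat a k (io w) != 0 -> exists2 u : I, u = a :: w :> seq _ & k = io u.
Proof.
rewrite mxE; case: existsP => [[u /existsP[w' /and3P[/eqP e /eqP-> /eqP/io_inj->]]] _|].
  by exists u.
by rewrite eqxx.
Qed.

(** Creation of x_j plus annihilation of x_j^T: each letter then evaluates to its own creation plus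
    the annihilation of its transpose. *)
Let fock (j : 'I_g) : 'M[R]_n := creat (inl j) + (creat (inr j))^T.

Let xval_fock a : xval fock a = creat a + (creat (xvar_tr a))^T.
Proof. by case: a => j //=; rewrite /fock linearD /= trmxK addrC. Qed.

Let vac : 'cV[R]_n := \col_k (k == io (nil_bseq D (xvar g)))%:R.

(* Modulo shorter words, the word w maps the vacuum to the basis vector w. *)
Let fock_leading (w : seq (xvar g)) (u : I) :
  (size w <= size u)%N -> (wev (xval fock) w *m vac) (io u) 0 = (u == w :> seq _)%:R.
Proof.
elim: w u => [|a w IHw] u /= wu.
  by rewrite wev_nil mul1mx mxE (inj_eq io_inj).
rewrite wev_cons -mulmxA xval_fock mulmxDl mxE.
set x := _ *m vac in IHw *.
(* Annihilation reaches [u] only from a word one letter longer. That word is longer than [w], so [x]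
   has coordinate 0 there by induction. *)
have -> : ((creat (xvar_tr a))^T *m x) (io u) 0 = 0.
  rewrite mxE big1 // => k _; rewrite mxE.
  have [->|/creat_col[u' eu' ->]] := eqVneq (creat (xvar_tr a) k (io u)) 0.
    by rewrite mul0r.
  have su' : (size w < size u')%N by rewrite eu' /= (leq_trans wu).
  rewrite IHw 1?ltnW //; case: eqVneq => [e|]; last by rewrite mulr0.
  by move: su'; rewrite e ltnn.
rewrite addr0 mxE.
case: u wu => -[|b u] uD //= wu.
have u'D : (size u <= D)%N by exact: ltnW.
rewrite (bigD1 (io (Bseq u'D))) //= big1 => [|l lu].
  rewrite creatE addr0 IHw //= [in RHS]eqseq_cons.
  by rewrite eqseq_cons eqxx andbT; case: eqP; rewrite ?mul1r ?mul0r.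
have [->|/creat_row[w' /= [_ ew'] el]] := eqVneq (creat a (io (Bseq uD)) l) 0.
  by rewrite mul0r.
by case/eqP: lu; rewrite el; congr io; apply: val_inj.
Qed.

(** In a vanishing combination of rows, the coordinate at a longest word with nonzero coefficient
    equals that coefficient, by [fock_leading]. *)
Lemma fock_row_free : exists X v, row_free (orbit_mx X v).
Proof.
exists fock, vac; apply: inj_row_free => c cM.
apply/rowP => i0; rewrite mxE; apply/eqP/negP => /negP ci0.
case: (@arg_maxnP _ i0 (fun i => c 0 i != 0) (fun i => size (enum_val i : I)) ci0).
move=> i ci imax.
move/(congr1 (fun M : 'rV_n => M 0 (io (enum_val i)))): cM.
rewrite mxE [RHS]mxE (bigD1 i) //= big1 => [|j ji].
  by rewrite addr0 mxE fock_leading // eqxx mulr1; move/eqP: ci.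
have [->|cj] := eqVneq (c 0 j) 0; first by rewrite mul0r.
rewrite mxE fock_leading; last exact: imax.
case: eqVneq => [/val_inj /enum_val_inj e|]; last by rewrite mulr0.
by rewrite e eqxx in ji.
Qed.

End Fock.

(** * Separating points of an nc open set *)

Section AffinePencil.
Variables (R : realType) (g n : nat).
Implicit Types X Y : 'I_g -> 'M[R]_n.

Definition pencil X Y (t : R) : {ptws 'I_g -> 'M[R]_n} :=
  fun j => X j + t *: (Y j - X j).

Lemma pencil_continuous X Y : continuous (pencil X Y).
Proof.
move=> t; apply/cvg_sup => j U [V [[W oW <-]] Wt WU].
apply: (filterS WU).
have cj : {for t, continuous (fun s : R => X j + s *: (Y j - X j))}.
  apply: continuousD; first exact: cst_continuous.
  by apply: continuousZr_tmp.
by apply: cj; apply: open_nbhs_nbhs; split.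
Qed.

Lemma poly_nbhs_nonroot (P : {poly R}) (U : set R) :
  P != 0 -> nbhs (0 : R) U -> exists2 t, U t & P.[t] != 0.
Proof.
move=> P0 /nbhs_ballP[e /= e0 eU].
apply: contrapT => noU.
(* These are [size P] distinct points, one more than the degree allows as roots; denominators start
   at 2 to stay strictly inside the ball. *)
pose r := [seq e / k.+2%:R | k <- iota 0 (size P)].
suff : (size r < size P)%N by rewrite size_map size_iota ltnn.
apply: max_poly_roots => //.
  apply/allP => t /mapP[k _ ->{t}]; apply/rootP; apply: contrapT => /eqP Pt.
  apply: noU; exists (e / k.+2%:R) => //; apply: eU.
  rewrite -ball_normE /= sub0r normrN gtr0_norm ?divr_gt0 //.
  by rewrite ltr_pdivrMr // ltr_pMr // ltr1n.
rewrite map_inj_uniq ?iota_uniq // => k l /(mulfI (lt0r_neq0 e0)) /invr_inj /eqP.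
by rewrite eqr_nat => /eqP [].
Qed.

(** The matrix is built over [{poly R}]; evaluation at t is a ring morphism, so it commutes with
    products and determinants. *)
Lemma pencil_orbit_det D X Y (v : 'cV[R]_n) (B : 'M[R]_(n, #|{bseq D of xvar g}|)) :
  exists P : {poly R}, forall t, P.[t] = \det (orbit_mx D (pencil X Y t) v *m B).
Proof.
pose Xp a := map_mx polyC (xval X a) + 'X *: map_mx polyC (xval Y a - xval X a).
pose Mp := \matrix_(i < #|{bseq D of xvar g}|, k < n)
  ((\prod_(a <- enum_val i) Xp a) *m map_mx polyC v) k 0.
exists (\det (Mp *m map_mx polyC B)) => t.
rewrite -horner_evalE -det_map_mx map_mxM.
have cK m1 m2 (C : 'M[R]_(m1, m2)) : map_mx (horner_eval t) (map_mx polyC C) = C.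
  by apply/matrixP => i j; rewrite !mxE horner_evalE hornerC.
have XpE a : map_mx (horner_eval t) (Xp a) = xval (pencil X Y t) a.
  have -> : xval (pencil X Y t) a = xval X a + t *: (xval Y a - xval X a).
    by case: a => j //=; rewrite /pencil linearD /= linearZ /= linearB.
  rewrite /Xp map_mxD map_mxZ !cK; congr (_ + _ *: _).
  exact: hornerX.
have WpE w : map_mx (horner_eval t) (\prod_(a <- w) Xp a) = wev (xval (pencil X Y t)) w.
  elim: w => [|a w IHw]; first by rewrite big_nil wev_nil map_mx1.
  by rewrite big_cons wev_cons -XpE -IHw; exact: map_mxM.
rewrite cK; congr (\det (_ *m B)); apply/matrixP => i k.
rewrite !mxE -WpE -[in RHS](cK _ _ v) rmorph_sum; apply: eq_bigr => j _.
by rewrite rmorphM; congr (_ * _); rewrite [RHS]mxE.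
Qed.
End AffinePencil.

Lemma nc_open_large (R : realType) g (G : ncset R g) (K : nat) :
  nc_open_set G -> exists n, (K < n)%N /\ (G n !=set0)%classic.
Proof.
case=> -[n n0 [X GX]] Gsum _; exists (\sum_(i < K.+1) n)%N; split.
  by rewrite sum_nat_const card_ord mulnC (leq_trans _ (leq_pmull _ n0)).
by exists (fun j => \mxdiag_(i < K.+1) X j); apply: Gsum.
Qed.

(* Along the segment from a point of a large level of G to the Fock tuple, a
   maximal minor of the matrix of the vectors w(X) v is a polynomial, nonzero at
   the Fock end, hence nonzero at points of G. *)
Lemma nc_open_interpolation (R : realType) g (G : ncset R g) (D : nat) :
  nc_open_set G -> exists n (X : {ptws 'I_g -> 'M[R]_n}) (v : 'cV[R]_n),
    [/\ (0 < n)%N, G n X & forall k (f : seq (xvar g) -> 'cV[R]_k),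
       exists K : 'M[R]_(k, n), forall w, (size w <= D)%N ->
         K *m (wev (xval X) w *m v) = f w].
Proof.
move=> Gopen; pose I : finType := D.-bseq (xvar g).
have [_ _ [n0 _ Gn0]] := Gopen.
(* A level above [n0] makes [G n] open; a level of at least [#|I|] makes room for the Fock tuple. *)
have [n [nlarge [X GX]]] := nc_open_large (n0 + #|I|) Gopen.
have n0n : (n0 < n)%N by rewrite (leq_ltn_trans _ nlarge) ?leq_addr.
have In : (#|I| <= n)%N by rewrite ltnW // (leq_ltn_trans _ nlarge) ?leq_addl.
have [Y [v /row_freeP[B YB]]] := fock_row_free R In.
have [P PE] := pencil_orbit_det X Y v B.
have P0 : P != 0.
  apply/eqP => P0; have := PE 1; rewrite P0 horner0.
  have -> : pencil X Y 1 = Y by apply: funext => j; rewrite /pencil scale1r addrC subrK.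
  by rewrite YB det1 => /eqP; rewrite eq_sym oner_eq0.
have nG : nbhs (0 : R) (pencil X Y @^-1` G n)%classic.
  apply: pencil_continuous; apply: open_nbhs_nbhs; split; first exact: Gn0.
  have -> // : pencil X Y 0 = X by apply: funext => j; rewrite /pencil scale0r addr0.
have [t GZ Pt] := poly_nbhs_nonroot P0 nG.
set Z := pencil X Y t in GZ.
exists n, Z, v; split=> // [|k f]; first by rewrite (leq_ltn_trans _ n0n).
have {}Pt : orbit_mx D Z v *m B \in unitmx by rewrite unitmxE -PE unitfE.
(* [C] is a right inverse of the orbit matrix, so [C^T] maps w(Z) v to the basis vector of w, and
   the images [f w] can be prescribed freely. *)
pose C := B *m invmx (orbit_mx D Z v *m B).
have ZC : orbit_mx D Z v *m C = 1%:M by rewrite mulmxA mulmxV.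
exists ((\matrix_(i < k, j < #|I|) f (enum_val j) i 0) *m C^T) => w wD.
have -> : wev (xval Z) w *m v = col (enum_rank (Bseq wD : I)) (orbit_mx D Z v)^T.
  by apply/colP => i; rewrite !mxE enum_rankK.
rewrite colE mulmxA -[_ *m C^T *m _]mulmxA -trmx_mul ZC trmx1 mulmx1 -colE.
by apply/colP => i; rewrite !mxE enum_rankK.
Qed.

(** * Direct sums *)

Section BlockInclusion.
Variables (R : realType) (t : nat) (n : 'I_t -> nat).

(** Comparing the values of the indices avoids a cast between the dimensions [n k] and [n i]. *)
Definition block_eq (k i : 'I_t) : 'M[R]_(n k, n i) :=
  \matrix_(a, b) ((k == i) && (a == b :> nat))%:R.

Definition block_inc (i : 'I_t) : 'M[R]_(\sum_k n k, n i) := \mxcol_k block_eq k i.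

Lemma block_eq_id i : block_eq i i = 1%:M.
Proof. by apply/matrixP => a b; rewrite !mxE eqxx. Qed.

Lemma block_eq_neq k i : k != i -> block_eq k i = 0.
Proof. by move=> ki; apply/matrixP => a b; rewrite !mxE (negPf ki). Qed.

Lemma mxdiag_block_inc (B : forall k, 'M[R]_(n k)) i :
  \mxdiag_k B k *m block_inc i = block_inc i *m B i.
Proof.
rewrite mul_mxdiag_mxcol mxcol_mul; apply/eq_mxcol => k.
have [->|ki] := eqVneq k i; first by rewrite block_eq_id mulmx1 mul1mx.
by rewrite block_eq_neq // mulmx0 mul0mx.
Qed.

Lemma block_inc_iso i : (block_inc i)^T *m block_inc i = 1%:M.
Proof.
rewrite tr_mxcol mul_mxrow_mxcol (bigD1 i) //= big1 => [|k ki].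
  by rewrite block_eq_id trmx1 mulmx1 addr0.
by rewrite block_eq_neq // mulmx0.
Qed.

Lemma block_inc_orth i j : i != j -> (block_inc i)^T *m block_inc j = 0.
Proof.
move=> ij; rewrite tr_mxcol mul_mxrow_mxcol big1 // => k _.
have [->|ki] := eqVneq k i; first by rewrite (block_eq_neq ij) mulmx0.
by rewrite (block_eq_neq ki) trmx0 mul0mx.
Qed.

End BlockInclusion.

(** Intertwining isometries with orthogonal ranges stand for the two summands, so that later
    computations need no explicit blocks. *)
Lemma nc_open_sum (R : realType) g (G : ncset R g) n m
    (X : {ptws 'I_g -> 'M[R]_n}) (Y : {ptws 'I_g -> 'M[R]_m}) :
  nc_open_set G -> (0 < n)%N -> (0 < m)%N -> G n X -> G m Y ->
  exists l (W : {ptws 'I_g -> 'M[R]_l}) (E : 'M[R]_(l, n)) (F : 'M[R]_(l, m)),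
    [/\ (0 < l)%N /\ G l W,
        [/\ E^T *m E = 1%:M, F^T *m F = 1%:M & F^T *m E = 0],
        forall a, xval W a *m E = E *m xval X a
      & forall a, xval W a *m F = F *m xval Y a].
Proof.
move=> [_ Gsum _] n0 m0 GX GY.
pose d (i : 'I_2) := if val i is 0%N then n else m.
pose Z (i : 'I_2) : 'I_g -> 'M[R]_(d i) :=
  match val i as k return 'I_g -> 'M[R]_(if k is 0%N then n else m) with
  | 0%N => X | _ => Y end.
have d0 i : (0 < d i)%N by rewrite /d; case: (val i).
have GZ i : G (d i) (Z i) by rewrite /d /Z; case: (val i).
pose i0 : 'I_2 := @Ordinal 2 0 isT; pose i1 : 'I_2 := @Ordinal 2 1 isT.
have ZE i a : xval (fun j => \mxdiag_k Z k j) a *m block_inc R d i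
              = block_inc R d i *m xval (Z i) a.
  by case: a => j /=; rewrite ?tr_mxdiag mxdiag_block_inc.
exists (\sum_i d i)%N, (fun j => \mxdiag_i Z i j), (block_inc R d i0), (block_inc R d i1).
split.
- by split; [rewrite (bigD1 i0) //= ltn_addr | apply: Gsum].
- split; [exact: (block_inc_iso R d i0) | exact: (block_inc_iso R d i1) |].
  exact: (@block_inc_orth R 2 d i1 i0).
- exact: (ZE i0).
- exact: (ZE i1).
Qed.

(** * Linear maps on the free algebra *)

Section LinearExtension.
Variables (R : comNzRingType) (K : choiceType) (V : lmodType R) (f : K -> V).

(** [nc_incl], [nc_tr] and [nc_eval] are instances, so their linearity is proved once. *)
Definition lext (p : {malg R[K]}) : V := \sum_(w <- msupp p) p@_w *: f w.

Lemma lextEw (d : {fset K}) p : (msupp p `<=` d)%fset ->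
  lext p = \sum_(w <- d) p@_w *: f w.
Proof.
move=> le; rewrite /lext (big_fset_incl _ le) => //= w _ /mcoeff_outdom ->.
by rewrite scale0r.
Qed.

Lemma lext_is_linear : linear lext.
Proof.
move=> c p q; pose d := (msupp p `|` msupp q `|` msupp (c *: p + q))%fset.
rewrite !(@lextEw d); first last.
- exact: fsubsetUr.
- by rewrite /d -fsetUA fsubsetUl.
- by rewrite /d fsetUAC fsubsetUr.
rewrite scaler_sumr -big_split /=; apply: eq_bigr => w _.
by rewrite mcoeffD mcoeffZ scalerDl scalerA.
Qed.

HB.instance Definition _ := GRing.isLinear.Build R {malg R[K]} V *:%R lext
  lext_is_linear.

Lemma lextU c w : lext << c *g w >> = c *: f w.
Proof. by rewrite (lextEw msuppU_le) big_seq_fset1 mcoeffUU. Qed.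

End LinearExtension.

Section MonoidAlgebra.
Variables (R : comNzRingType) (K : monomType).

Lemma malgUZ c (w : K) : << c *g w >> = c *: << w >> :> {malg R[K]}.
Proof. by apply/malgP => k; rewrite mcoeffZ !mcoeffU mulrnAr mulr1. Qed.

Lemma malgUM c d (u w : K) :
  << c *g u >> * << d *g w >> = << c * d *g mmul u w >> :> {malg R[K]}.
Proof. by rewrite malgM_def; exact: fgmulUU. Qed.

Lemma malg_ind (P : {malg R[K]} -> Prop) :
  P 0 -> (forall p q, P p -> P q -> P (p + q)) ->
  (forall c w, P << c *g w >>) -> forall p, P p.
Proof. by move=> P0 PD PU p; rewrite (monalgE p); apply: big_ind. Qed.

(** A general [op] covers both multiplicative maps and the transpose, which reverses products. *)
Lemma malg_bilinear_ext (V : zmodType) (f : {malg R[K]} -> V) (op : V -> V -> V) :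
  f 0 = 0 -> {morph f : p q / p + q} ->
  (forall x, {morph op x : y z / y + z}) -> (forall y, {morph op^~ y : x z / x + z}) ->
  (forall c d u w, f << c * d *g mmul u w >> = op (f << c *g u >>) (f << d *g w >>)) ->
  forall p q, f (p * q) = op (f p) (f q).
Proof.
move=> f0 fD opDr opDl fU.
have opx0 x : op x 0 = 0 by apply: (addrI (op x 0)); rewrite -opDr !addr0.
have op0y y : op 0 y = 0 by apply: (addrI (op 0 y)); rewrite -opDl !addr0.
move=> p q; elim/malg_ind: p => [|p1 p2 IH1 IH2|c u].
- by rewrite mul0r f0 op0y.
- by rewrite mulrDl (fD (p1 * q) (p2 * q)) (fD p1 p2) opDl IH1 IH2.
elim/malg_ind: q => [|p1 p2 IH1 IH2|d w].
- by rewrite mulr0 f0 opx0.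
- by rewrite mulrDr (fD (_ * p1) (_ * p2)) (fD p1 p2) opDr IH1 IH2.
by rewrite malgUM fU.
Qed.

End MonoidAlgebra.

Section NcMaps.
Variable R : realType.

Lemma nc_incl_lext g (p : ncpoly R (xvar g)) :
  nc_incl p = lext (fun w => << word_incl w >> : ncpoly R (xhvar g)) p.
Proof. by apply: eq_bigr => w _; rewrite malgUZ. Qed.

Lemma nc_inclU g c w :
  nc_incl << c *g w >> = << c *g word_incl w >> :> ncpoly R (xhvar g).
Proof. by rewrite nc_incl_lext lextU -malgUZ. Qed.

Lemma nc_incl0 g : nc_incl (0 : ncpoly R (xvar g)) = 0.
Proof. by rewrite nc_incl_lext linear0. Qed.

Lemma nc_inclD g (p q : ncpoly R (xvar g)) : nc_incl (p + q) = nc_incl p + nc_incl q.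
Proof. by rewrite !nc_incl_lext linearD. Qed.

Lemma nc_incl_sum g (I : Type) (r : seq I) (F : I -> ncpoly R (xvar g)) :
  nc_incl (\sum_(i <- r) F i) = \sum_(i <- r) nc_incl (F i).
Proof. exact: (big_morph _ (@nc_inclD g) (@nc_incl0 g)). Qed.

Lemma nc_inclM g (p q : ncpoly R (xvar g)) : nc_incl (p * q) = nc_incl p * nc_incl q.
Proof.
apply: (malg_bilinear_ext (f := @nc_incl R g) (op := *%R)) => {p q}.
- exact: nc_incl0.
- exact: nc_inclD.
- exact: mulrDr.
- by move=> y x z; exact: mulrDl.
move=> c d u w; rewrite !nc_inclU malgUM; congr << _ *g _ >>.
by rewrite /word_incl /mmul /= !fmmulE /= map_cat.
Qed.

Section Transpose.
Variables (A : choiceType) (s : A -> A).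

Lemma nc_tr_lext p : nc_tr s p = lext (fun w => << word_tr s w >> : ncpoly R A) p.
Proof. by apply: eq_bigr => w _; rewrite malgUZ. Qed.

Lemma nc_trU c w : nc_tr s << c *g w >> = << c *g word_tr s w >> :> ncpoly R A.
Proof. by rewrite nc_tr_lext lextU -malgUZ. Qed.

Lemma nc_tr0 : nc_tr s (0 : ncpoly R A) = 0.
Proof. by rewrite nc_tr_lext linear0. Qed.

Lemma nc_trD (p q : ncpoly R A) : nc_tr s (p + q) = nc_tr s p + nc_tr s q.
Proof. by rewrite !nc_tr_lext linearD. Qed.

Lemma nc_tr_sum (I : Type) (r : seq I) (F : I -> ncpoly R A) :
  nc_tr s (\sum_(i <- r) F i) = \sum_(i <- r) nc_tr s (F i).
Proof. exact: (big_morph _ nc_trD nc_tr0). Qed.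

Lemma nc_trC c : nc_tr s c%:MP = c%:MP :> ncpoly R A.
Proof. by rewrite nc_trU; congr << _ *g _ >>; rewrite /word_tr fm1 /mone /= fmoneE. Qed.

Lemma nc_trM (p q : ncpoly R A) : nc_tr s (p * q) = nc_tr s q * nc_tr s p.
Proof.
apply: (malg_bilinear_ext (f := nc_tr s) (op := fun x y => y * x)) => {p q}.
- exact: nc_tr0.
- exact: nc_trD.
- by move=> x y z; exact: mulrDl.
- by move=> y x z; exact: mulrDr.
move=> c d u w; rewrite !nc_trU malgUM mulrC; congr << _ *g _ >>.
by rewrite /word_tr /mmul /= !fmmulE /= map_cat rev_cat.
Qed.

Lemma ncmx_trE m n (M : 'M[ncpoly R A]_(m, n)) i j : ncmx_tr s M i j = nc_tr s (M j i).
Proof. by rewrite !mxE. Qed.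

Lemma ncmx_trM m n k (M : 'M[ncpoly R A]_(m, n)) (N : 'M[ncpoly R A]_(n, k)) :
  ncmx_tr s (M *m N) = ncmx_tr s N *m ncmx_tr s M.
Proof.
apply/matrixP => i j; rewrite ncmx_trE !mxE nc_tr_sum; apply: eq_bigr => l _.
by rewrite nc_trM !ncmx_trE.
Qed.

Lemma ncmx_tr_const m n (M : 'M[R]_(m, n)) :
  ncmx_tr s (map_mx (fun c => c%:MP) M) = map_mx (fun c => c%:MP) M^T.
Proof. by apply/matrixP => i j; rewrite ncmx_trE !mxE nc_trC. Qed.

End Transpose.

Section Evaluation.
Variables (n : nat) (A : choiceType) (v : A -> 'M[R]_n).

Lemma nc_eval_lext p : nc_eval v p = lext (fun w : {fmonom A} => wev v w) p.
Proof. by []. Qed.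

Lemma nc_evalU c w : nc_eval v << c *g w >> = c *: wev v w.
Proof. by rewrite nc_eval_lext lextU. Qed.

Lemma nc_eval0 : nc_eval v 0 = 0.
Proof. by rewrite nc_eval_lext linear0. Qed.

Lemma nc_evalD p q : nc_eval v (p + q) = nc_eval v p + nc_eval v q.
Proof. by rewrite !nc_eval_lext linearD. Qed.

Lemma nc_evalZ c p : nc_eval v (c *: p) = c *: nc_eval v p.
Proof. by rewrite !nc_eval_lext linearZ. Qed.

Lemma nc_eval_sum (I : Type) (r : seq I) (F : I -> ncpoly R A) :
  nc_eval v (\sum_(i <- r) F i) = \sum_(i <- r) nc_eval v (F i).
Proof. exact: (big_morph _ nc_evalD nc_eval0). Qed.

Lemma nc_evalM p q : nc_eval v (p * q) = nc_eval v p *m nc_eval v q.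
Proof.
apply: (malg_bilinear_ext (f := nc_eval v) (op := *%R)) => {p q}.
- exact: nc_eval0.
- exact: nc_evalD.
- exact: mulrDr.
- by move=> y x z; exact: mulrDl.
move=> c d u w; rewrite !nc_evalU -[RHS]/(_ *m _) -scalemxAl -scalemxAr scalerA.
by rewrite -wev_cat /mmul /= fmmulE.
Qed.

End Evaluation.
End NcMaps.

(** * First and mixed second derivatives of words *)

Section Marks.
Variables (S : pzRingType) (g : nat) (x h : xvar g -> S).
Notation word := (seq (xvar g)).

Definition mon (w : word) : S := \prod_(a <- w) x a.

(* The sum of the products obtained from mon w by replacing one factor x a,
   among those with s a, by h a. *)
Fixpoint mark (s : pred (xvar g)) (w : word) : S :=
  if w is a :: w' then x a * mark s w' + (if s a then h a * mon w' else 0)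
  else 0.

(* The same with two replacements, of one x_j and of one x_k^T. *)
Fixpoint mark2 (w : word) : S :=
  if w is a :: w' then
    x a * mark2 w' + h a * mark (fun b => is_inl b != is_inl a) w'
  else 0.

Lemma mon_nil : mon [::] = 1.
Proof. by rewrite /mon big_nil. Qed.

Lemma mon_cons a w : mon (a :: w) = x a * mon w.
Proof. by rewrite /mon big_cons. Qed.

Lemma mon_cat u w : mon (u ++ w) = mon u * mon w.
Proof. by rewrite /mon big_cat. Qed.

Lemma eq_mark s1 s2 w : {in w, s1 =1 s2} -> mark s1 w = mark s2 w.
Proof.
elim: w => //= a w IHw e; rewrite e ?mem_head // IHw // => b bw.
by rewrite e // in_cons bw orbT.
Qed.

Lemma mark_pred0 w : mark pred0 w = 0.
Proof. by elim: w => //= a w ->; rewrite mulr0 addr0. Qed.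

Lemma mark_cat s u w : mark s (u ++ w) = mark s u * mon w + mon u * mark s w.
Proof.
elim: u => [|a u IHu] /=; first by rewrite mul0r add0r mon_nil mul1r.
rewrite IHu mon_cons mon_cat mulrDr mulrDl !mulrA -!addrA; congr (_ + _).
by rewrite addrC; congr (_ + _); case: (s a); rewrite ?mul0r // mulrA.
Qed.

Definition pure b (w : word) := all (fun a => is_inl a == b) w.

Lemma pure_wtr b w : pure b (wtr w) = pure (~~ b) w.
Proof.
rewrite /pure /wtr all_rev all_map; apply: eq_all => a /=.
by rewrite xvar_tr_type; case: b (is_inl a) => [] [].
Qed.

Lemma mark2_pure b w : pure b w -> mark2 w = 0.
Proof.
elim: w => //= a w IHw /andP[/eqP ab pw]; rewrite IHw // mulr0 add0r.
rewrite (@eq_mark _ pred0) ?mark_pred0 ?mulr0 // => c /(allP pw) /eqP ->.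
by rewrite ab eqxx.
Qed.

(** The two replaced letters have different types, so one lies in [u] and the other in [w]. This
    gives the hessian its Gram structure. *)
Lemma mark2_cat b u w : pure (~~ b) u -> pure b w ->
  mark2 (u ++ w) = mark predT u * mark predT w.
Proof.
move=> pu pw; elim: u pu => [|a u IHu] /=; first by rewrite mul0r (mark2_pure pw).
case/andP=> /eqP ab pu; rewrite IHu // mark_cat.
pose s (c : xvar g) := is_inl c != is_inl a; rewrite -/s.
rewrite (@eq_mark s pred0 u) => [|c /(allP pu) /eqP cb]; last by rewrite /s cb ab eqxx.
rewrite (@eq_mark s predT w) => [|c /(allP pw) /eqP cb]; last by rewrite /s cb ab; case: (b).
by rewrite mark_pred0 mul0r add0r mulrDl !mulrA.
Qed.

(** Serves for the matrix transpose and for the involution of the free algebra. *)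
Lemma mark_antimorph (t : S -> S) s w :
  t 0 = 0 -> t 1 = 1 -> {morph t : y z / y + z} ->
  (forall y z, t (y * z) = t z * t y) ->
  (forall a, t (x a) = x (xvar_tr a)) -> (forall a, t (h a) = h (xvar_tr a)) ->
  t (mark s w) = mark (fun a => s (xvar_tr a)) (wtr w).
Proof.
move=> t0 t1 tD tM tx th.
have t_mon u : t (mon u) = mon (wtr u).
  elim: u => [|a u IHu]; first by rewrite mon_nil.
  by rewrite mon_cons tM wtr_cons mon_cat mon_cons mon_nil mulr1 tx IHu.
elim: w => [|a w IHw] //=.
rewrite tD tM IHw tx wtr_cons mark_cat /= xvar_trK !mulr0 add0r.
rewrite mon_cons !mon_nil !mulr1; congr (_ + _); case: (s a); last by rewrite t0 mulr0.
by rewrite tM th t_mon.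
Qed.

End Marks.

Section MarksMorphism.
Variables (S S' : pzRingType) (g : nat) (x h : xvar g -> S) (f : S -> S').
Hypotheses (f0 : f 0 = 0) (f1 : f 1 = 1) (fD : {morph f : y z / y + z})
  (fM : {morph f : y z / y * z}).

Lemma mon_morph w : f (mon x w) = mon (f \o x) w.
Proof. by elim: w => [|a w IHw]; rewrite ?mon_nil // !mon_cons fM IHw. Qed.

Lemma mark_morph s w : f (mark x h s w) = mark (f \o x) (f \o h) s w.
Proof.
elim: w => //= a w IHw; rewrite fD fM IHw; case: (s a); last by rewrite f0.
by rewrite fM mon_morph.
Qed.

Lemma mark2_morph w : f (mark2 x h w) = mark2 (f \o x) (f \o h) w.
Proof. by elim: w => //= a w IHw; rewrite fD !fM IHw mark_morph. Qed.

End MarksMorphism.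

Section Perturbation.
Variables (S : nzRingType) (g : nat) (x h : xvar g -> S).

(* [x + t h, y + s k] on the letters, with [t] the inner indeterminate. *)
Definition stletter (a : xvar g) : {poly {poly S}} :=
  if is_inl a then (x a)%:P%:P + 'X%:P * (h a)%:P%:P
  else (x a)%:P%:P + 'X * (h a)%:P%:P.

(** The first index is the power of s, the second that of t. Coefficients of order at most one in
    each variable obey a closed recursion. *)
Lemma coef_stletterM a (T : {poly {poly S}}) :
  [/\ (stletter a * T)`_0`_0 = x a * T`_0`_0,
      (stletter a * T)`_0`_1 =
        x a * T`_0`_1 + (if is_inl a then h a * T`_0`_0 else 0),
      (stletter a * T)`_1`_0 =
        x a * T`_1`_0 + (if ~~ is_inl a then h a * T`_0`_0 else 0)
    & (stletter a * T)`_1`_1 =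
        x a * T`_1`_1 + h a * (if is_inl a then T`_1`_0 else T`_0`_1)].
Proof.
rewrite /stletter; case: (is_inl a); rewrite mulrDl -!mulrA /=;
  do !rewrite ?(coefD, coefCM, coefXM) /=; by split; rewrite ?coef0 ?addr0.
Qed.

Lemma coef_stword w (T := \prod_(a <- w) stletter a) :
  [/\ T`_0`_0 = mon x w, T`_0`_1 = mark x h (@is_inl _ _) w,
      T`_1`_0 = mark x h (fun a => ~~ is_inl a) w
    & T`_1`_1 = mark2 x h w].
Proof.
rewrite {}/T; elim: w => [|a w [IH00 IH01 IH10 IH11]].
  by rewrite big_nil; do !rewrite ?(coef1, coef0, mulr1n) /=; rewrite mon_nil.
rewrite big_cons mon_cons /=; set T := \prod_(_ <- w) _ in IH00 IH01 IH10 IH11 *.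
have [-> -> -> ->] := coef_stletterM a T.
rewrite IH00 IH01 IH10 IH11; split => //; congr (_ + _ * _).
by case: (is_inl a); apply: eq_mark => b _; case: (is_inl b).
Qed.

End Perturbation.

Section ComplexHessian.
Variables (R : realType) (g : nat).

Definition xlet (a : xvar g) : ncpoly R (xhvar g) := var R (inl a).
Definition hlet (a : xvar g) : ncpoly R (xhvar g) := var R (inr a).

Lemma nc_perturbE (p : ncpoly R (xvar g)) : nc_perturb p =
  \sum_(w <- msupp p) (p@_w)%:MP%:P%:P * \prod_(a <- w) stletter xlet hlet a.
Proof.
by apply: eq_bigr => w _; congr (_ * _); apply: eq_bigr => -[].
Qed.

Lemma complex_hessianE (p : ncpoly R (xvar g)) :
  complex_hessian p = \sum_(w <- msupp p) p@_w *: mark2 xlet hlet w.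
Proof.
rewrite /complex_hessian horner_coef0 horner_coef0 coef_deriv mulr1n.
rewrite coef_map_id0; last exact: deriv0.
rewrite coef_deriv mulr1n nc_perturbE !coef_sum.
apply: eq_bigr => w _; rewrite coefCM coefCM mul_malgC.
by have [_ _ _ ->] := coef_stword xlet hlet w.
Qed.

End ComplexHessian.

(** * Positivity of the hessian *)

Section Cuts.
Variable T : eqType.
Implicit Types (w c u d : seq T).

(** The nonempty factor carries the replaced letter: it is the last letter of the first factor for
    [cuts], the first letter of the second factor for [cocuts]. *)
Fixpoint cuts w : seq (seq T * seq T) :=
  if w is a :: w' then ([:: a], w') :: [seq (a :: t.1, t.2) | t <- cuts w']
  else [::].

Fixpoint cocuts w : seq (seq T * seq T) :=
  if w is a :: w' then ([::], w) :: [seq (a :: t.1, t.2) | t <- cocuts w']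
  else [::].

Lemma mem_cuts w t : t \in cuts w -> t.1 != [::] /\ w = t.1 ++ t.2.
Proof.
elim: w t => //= a w IHw t; rewrite in_cons => /orP[/eqP-> //|/mapP[s /IHw[_ ->] ->]].
by rewrite cat_cons.
Qed.

Lemma mem_cocuts w t : t \in cocuts w -> t.2 != [::] /\ w = t.1 ++ t.2.
Proof.
elim: w t => //= a w IHw t; rewrite in_cons => /orP[/eqP-> //|/mapP[s /IHw[tN ->] ->]].
by rewrite cat_cons.
Qed.

Variable R : pzSemiRingType.

Lemma sum_cuts w c d : c != [::] ->
  \sum_(t <- cuts w) (t == (c, d))%:R = (w == c ++ d)%:R :> R.
Proof.
elim: w c => [|a w IHw] [|b c] //= _; first by rewrite big_nil.
rewrite big_cons big_map /=; case: c => [|b' c].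
  rewrite big_seq big1 ?addr0 => [|[t1 t2] /mem_cuts[/= t1N _]].
    by rewrite xpair_eqE !eqseq_cons andbT.
  by rewrite xpair_eqE eqseq_cons (negPf t1N) andbF.
rewrite xpair_eqE !eqseq_cons andbF /= add0r.
under eq_bigr => t _ do rewrite xpair_eqE eqseq_cons -andbA -xpair_eqE -surjective_pairing.
have [_|ab] := eqVneq a b; first by rewrite IHw.
by rewrite big1.
Qed.

Lemma sum_cocuts w u d : d != [::] ->
  \sum_(t <- cocuts w) (t == (u, d))%:R = (w == u ++ d)%:R :> R.
Proof.
move=> dN; elim: w u => [|a w IHw] u /=.
  by rewrite big_nil eq_sym; case: u => //=; rewrite (negPf dN).
rewrite big_cons big_map /=; case: u => [|b u].
  by rewrite big1 ?addr0 // => t _; rewrite xpair_eqE.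
rewrite xpair_eqE /= add0r eqseq_cons.
under eq_bigr => t _ do rewrite xpair_eqE eqseq_cons -andbA -xpair_eqE -surjective_pairing.
have [_|ab] := eqVneq a b; first by rewrite IHw.
by rewrite big1.
Qed.

Lemma sum_cuts2 w c u d : c != [::] -> d != [::] ->
  \sum_(t <- cuts w) \sum_(r <- cocuts t.2) [&& t.1 == c, r.1 == u & r.2 == d]%:R
    = (w == c ++ u ++ d)%:R :> R.
Proof.
move=> cN dN; rewrite -sum_cuts //; apply: eq_bigr => -[t1 t2] _ /=.
rewrite xpair_eqE; have [_|tc] := eqVneq t1 c; last by rewrite big1.
by rewrite -sum_cocuts //; apply: eq_bigr => -[r1 r2] _; rewrite xpair_eqE.
Qed.

End Cuts.

(** * Derivatives along a direction between two orthogonal summands *)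

Section Witness.
Variables (R : realType) (g n m l D : nat).
Variables (X : 'I_g -> 'M[R]_n) (Y : 'I_g -> 'M[R]_m) (W : 'I_g -> 'M[R]_l).
Variables (E : 'M[R]_(l, n)) (F : 'M[R]_(l, m)).
Hypotheses (EE : E^T *m E = 1%:M) (FF : F^T *m F = 1%:M) (FE : F^T *m E = 0).
Hypotheses (WE : forall a, xval W a *m E = E *m xval X a)
  (WF : forall a, xval W a *m F = F *m xval Y a).
Variables (b : bool) (y : seq (xvar g) -> 'cV[R]_m) (v : 'cV[R]_n).
Variable K : xvar g -> 'M[R]_(m, n).
Hypothesis Ky : forall a w, (size w <= D)%N -> K a *m (wev (xval X) w *m v) = y (a :: w).
Hypothesis yb : forall a w, is_inl a != b -> y (a :: w) = 0.

(* The direction mapping the summand of X to that of Y, with the letters of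
   type b acting on the orbit of v as prescribed by y. *)
Definition dir (j : 'I_g) : 'M[R]_l :=
  if b then F *m K (inl j) *m E^T else E *m (K (inr j))^T *m F^T.

Lemma xval_dir a : xval dir a =
  if is_inl a == b then F *m K a *m E^T else E *m (K (xvar_tr a))^T *m F^T.
Proof.
rewrite /dir; case: a => j /=; case: (b) => //=.
  by rewrite !trmx_mul trmxK mulmxA.
by rewrite !trmx_mul !trmxK mulmxA.
Qed.

(** The component along [F] of the derivative of w, in the letters of type [b], applied to [E *m v];
    the recursion is the Leibniz rule. *)
Fixpoint zvec (w : seq (xvar g)) : 'cV[R]_m :=
  if w is a :: w' then xval Y a *m zvec w' + y w else 0.

Lemma zvecE w : zvec w = \sum_(t <- cocuts w) wev (xval Y) t.1 *m y t.2.
Proof.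
elim: w => [|a w IHw] /=; first by rewrite big_nil.
rewrite big_cons big_map /= wev_nil mul1mx addrC IHw mulmx_sumr; congr (_ + _).
by apply: eq_bigr => t _; rewrite wev_cons mulmxA.
Qed.

Notation markW := (mark (xval W) (xval dir)).

Lemma wev_inl w : wev (xval W) w *m (E *m v) = E *m (wev (xval X) w *m v).
Proof.
elim: w => [|a w IHw]; first by rewrite !wev_nil !mul1mx.
by rewrite !wev_cons -mulmxA IHw mulmxA WE !mulmxA.
Qed.

(** The bound is [D.+1] because [Ky] is applied only to the part of the word after the replaced
    letter. *)
Lemma mark_type w : (size w <= D.+1)%N ->
  markW (fun a => is_inl a == b) w *m (E *m v) = F *m zvec w.
Proof.
elim: w => [|a w IHw] /= wD; first by rewrite mul0mx mulmx0.
rewrite -[xval W a * _]/(_ *m _) mulmxDl -mulmxA IHw 1?ltnW // mulmxA WF.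
rewrite mulmxDr !mulmxA; congr (_ + _).
case: eqP => ab; last by rewrite yb ?mulmx0 ?mul0mx //; apply/eqP.
rewrite -[_ * mon _ _]/(_ *m _) -(mulmxA _ E) -mulmxA.
rewrite -[mon _ _]/(wev _ _) wev_inl xval_dir ab eqxx -!mulmxA.
by rewrite (mulmxA E^T) EE mul1mx Ky.
Qed.

(** Directions of the other type act through [F^T], which vanishes on the range of [E]. *)
Lemma mark_cotype w :
  markW (fun a => is_inl a != b) w *m (E *m v) = 0.
Proof.
elim: w => [|a w IHw] /=; first by rewrite mul0mx.
rewrite -[xval W a * _]/(_ *m _) mulmxDl -mulmxA IHw mulmx0 add0r.
case: ifP => ab; last by rewrite mul0mx.
rewrite -[_ * mon _ _]/(_ *m _) -mulmxA.
rewrite -[mon _ _]/(wev _ _) wev_inl xval_dir (negPf ab) -!mulmxA.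
by rewrite (mulmxA F^T) FE mul0mx !mulmx0.
Qed.

(** The prefix [c] collects the letters already read. The right replaced letter must lead from the
    summand of X to that of Y and the left one back, so only one order of types survives. *)
Lemma mark2_type c w : (size (c ++ w) <= D)%N ->
  v^T *m wev (xval X) c *m E^T *m mark2 (xval W) (xval dir) w *m (E *m v) =
  \sum_(t <- cuts w) (y (wtr (c ++ t.1)))^T *m zvec t.2.
Proof.
elim: w c => [|a w IHw] c /= cwD; first by rewrite mulmx0 mul0mx big_nil.
rewrite big_cons big_map /= mulmxDr mulmxDl addrC; congr (_ + _); last first.
  have -> : \sum_(t <- cuts w) (y (wtr (c ++ a :: t.1)))^T *m zvec t.2 =
      \sum_(t <- cuts w) (y (wtr ((c ++ [:: a]) ++ t.1)))^T *m zvec t.2.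
    by apply: eq_bigr => t _; rewrite -catA.
  rewrite -IHw -?catA // wev_cat wev_cons wev_nil mulmx1.
  rewrite -[xval W a * _]/(_ *m _) !mulmxA; congr (_ *m _ *m _ *m _).
  have := congr1 trmx (WE (xvar_tr a)); rewrite !trmx_mul !xval_tr !trmxK => WEt.
  by rewrite -!mulmxA WEt.
have -> : wtr (c ++ [:: a]) = xvar_tr a :: wtr c by rewrite wtr_cat wtr_cons.
rewrite -[xval dir a * _]/(_ *m _) -!mulmxA xval_dir.
have sc : (size c <= D)%N by rewrite (leq_trans _ cwD) // size_cat leq_addr.
have sw : (size w <= D.+1)%N.
  by apply: leqW; rewrite (leq_trans _ cwD) // size_cat /= -addSnnS leq_addl.
case: eqP => [ab|/eqP ab].
  rewrite [mark _ _ _ _](_ : _ = markW (fun c => is_inl c != b) w); last first.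
    by apply: eq_mark => d _; rewrite ab.
  rewrite mark_cotype !mulmx0 yb ?trmx0 ?mul0mx //.
  by rewrite xvar_tr_type ab; case: (b).
rewrite [mark _ _ _ _](_ : _ = markW (fun c => is_inl c == b) w); last first.
  by apply: eq_mark => d _; move: ab; case: (is_inl a) (is_inl d) (b) => [] [] [].
rewrite mark_type // -!mulmxA (mulmxA E^T) EE mul1mx (mulmxA F^T) FF mul1mx.
by rewrite -(Ky _ (w := wtr c)) ?size_wtr // wev_wtr !trmx_mul trmxK !mulmxA.
Qed.

End Witness.

Lemma nc_eval_mark2 (R : realType) g l (W H : 'I_g -> 'M[R]_l) w :
  nc_eval (xhval W H) (mark2 (@xlet R g) (@hlet R g) w) = mark2 (xval W) (xval H) w.
Proof.
have ev a : nc_eval (xhval W H) (var R a) = xhval W H a.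
  by rewrite nc_evalU scale1r fmU wev_cons wev_nil mulmx1.
rewrite (@mark2_morph _ _ g _ _ (nc_eval (xhval W H))).
- by congr (mark2 _ _ w); apply: funext => a /=; rewrite ev.
- exact: nc_eval0.
- by rewrite nc_evalU scale1r fm1 wev_nil.
- exact: nc_evalD.
- exact: nc_evalM.
Qed.

Section Plush.
Variables (R : realType) (g : nat) (p : ncpoly R (xvar g)) (G : ncset R g).
Hypotheses (p_sym : nc_symmetric p) (G_open : nc_open_set G) (p_plush : nc_plush G p).
Variable D : nat.
Hypothesis pD : forall w, w \in msupp p -> (size w <= D)%N.

(* Evaluating the hessian at X (+) Y in the direction [dir], on the vector
   (v, 0) where v is a separating vector for X, gives the quadratic form on the
   left; dir maps the summand of X to that of Y, so only Y and y matter. *)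
Lemma plush_test (b : bool) m (Y : {ptws 'I_g -> 'M[R]_m})
    (y : seq (xvar g) -> 'cV[R]_m) :
  (0 < m)%N -> @G m Y -> (forall a w, is_inl a != b -> y (a :: w) = 0) ->
  exists tau : seq (xvar g) -> R,
    [/\ 0 <= \sum_(w <- msupp p) p@_w * tau w,
        forall w, (size w <= D)%N -> tau w =
          \sum_(t <- cuts w) ((y (wtr t.1))^T *m zvec Y y t.2) 0 0,
        forall c d, pure b c -> pure b d -> (size c <= D)%N -> (size d <= D)%N ->
          tau (wtr c ++ d) = ((zvec Y y c)^T *m zvec Y y d) 0 0
      & forall c d, pure (~~ b) c -> pure (~~ b) d -> tau (wtr c ++ d) = 0].
Proof.
move=> m0 GY yb.
have [n [X [v [n0 GX Kv]]]] := nc_open_interpolation D G_open.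
have [l [W [E [F [[l0 GW] [EE FF FE] WE WF]]]]] := nc_open_sum G_open n0 m0 GX GY.
have /choice[K Ky] : forall a, exists K : 'M[R]_(m, n), forall w, (size w <= D)%N ->
    K *m (wev (xval X) w *m v) = y (a :: w).
  by move=> a; exact: (Kv m (fun w => y (a :: w))).
pose H := dir E F b K; pose Ev := E *m v.
pose M w := mark2 (xval W) (xval H) w.
(* The derivative of [wtr c] is the transpose of that of [c], so [mark2_cat] yields an inner
   product. *)
have Mcat b' c d (V : 'cV_l) : pure b' c -> pure b' d -> V^T *m M (wtr c ++ d) *m V =
    (mark (xval W) (xval H) predT c *m V)^T *m (mark (xval W) (xval H) predT d *m V).
  move=> pc pd; rewrite /M (@mark2_cat _ _ _ _ b') ?pure_wtr ?negbK //.
  rewrite -[mark _ _ predT (wtr c) * _]/(_ *m _) trmx_mul !mulmxA.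
  congr (_ *m _ *m _ *m _).
  symmetry; apply: (@mark_antimorph _ g (xval W) (xval H) (@trmx R l l) predT c).
  - exact: trmx0.
  - exact: trmx1.
  - by move=> ? ?; exact: linearD.
  - by move=> ? ?; exact: trmx_mul.
  - by move=> a; rewrite xval_tr.
  - by move=> a; rewrite xval_tr.
exists (fun w => (Ev^T *m M w *m Ev) 0 0); split.
- have [_ /(_ Ev)] := p_plush l0 GW H.
  rewrite complex_hessianE nc_eval_sum mulmx_sumr mulmx_suml summxE.
  congr (0 <= _); apply: eq_bigr => w _.
  by rewrite nc_evalZ nc_eval_mark2 -scalemxAr -scalemxAl mxE.
- move=> w wD.
  have := @mark2_type _ _ _ _ _ _ X Y W E F EE FF FE WE WF b y v K Ky yb [::] w wD.
  by rewrite wev_nil mulmx1 trmx_mul => ->; rewrite summxE.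
- move=> c d pc pd cD dD; rewrite (Mcat b) //.
  have mT w : pure b w -> (size w <= D)%N ->
      mark (xval W) (xval H) predT w *m Ev = F *m zvec Y y w.
    move=> pw wD.
    rewrite -(@mark_type _ _ _ _ _ _ X Y W E F EE WE WF b y v K Ky yb) ?leqW //.
    by congr (_ *m _); apply: eq_mark => a /(allP pw) ->.
  by rewrite !mT // trmx_mul -mulmxA (mulmxA F^T) FF mul1mx.
move=> c d pc pd; rewrite (Mcat (~~ b)) //.
suff -> : mark (xval W) (xval H) predT d *m Ev = 0 by rewrite mulmx0 mxE.
rewrite -[RHS](mark_cotype FE WE b v K d).
congr (_ *m _); apply: eq_mark => a /(allP pd) /eqP ->; by case: (b).
Qed.

Definition wcoef (w : seq (xvar g)) : R := p@_(FMonom w).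

Lemma wcoef_wtr w : wcoef (wtr w) = wcoef w.
Proof.
have coef_tr (q : ncpoly R (xvar g)) u :
    (nc_tr (@xvar_tr g) q)@_(FMonom (wtr u)) = q@_(FMonom u).
  elim/malg_ind: q => [|q1 q2 IH1 IH2|c u'].
  - by rewrite nc_tr0 !mcoeff0.
  - by rewrite nc_trD !mcoeffD IH1 IH2.
  rewrite nc_trU !mcoeffU; congr (_ *+ nat_of_bool _).
  by rewrite !fmP /= -/(wtr u') (inj_eq (inv_inj (@wtrK g))).
by rewrite /wcoef -[in LHS]p_sym coef_tr.
Qed.

Lemma wcoef_size w : (D < size w)%N -> wcoef w = 0.
Proof.
move=> Dw; rewrite /wcoef; apply: mcoeff_outdom; apply/negP => /pD /=.
by rewrite leqNgt Dw.
Qed.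

Lemma sum_wcoef u : \sum_(w <- msupp p) p@_w * (w == u :> seq _)%:R = wcoef u.
Proof.
rewrite /wcoef; case: (msuppP p (FMonom u)) => [up|up].
  rewrite (big_fsetD1 (FMonom u)) //= eqxx mulr1 big_seq big1 ?addr0 // => w.
  rewrite in_fsetD1 => /andP[wu _]; rewrite -[w == u :> seq _]/(_ == (FMonom u : seq _)).
  by rewrite -fmP (negPf wu) mulr0.
rewrite big_seq big1 // => w wp; case: eqP => [e|]; last by rewrite mulr0.
by move: up; rewrite -e fmK wp.
Qed.

End Plush.

(** * Vanishing of the mixed coefficients *)

Section Vanishing.
Variables (R : realType) (g : nat) (p : ncpoly R (xvar g)) (G : ncset R g).
Hypotheses (p_sym : nc_symmetric p) (G_open : nc_open_set G) (p_plush : nc_plush G p).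
Variable D : nat.
Hypothesis pD : forall w, w \in msupp p -> (size w <= D)%N.

(* A positive semidefinite form with a zero on the diagonal, at a, has zero
   coefficients on the whole row of a. *)
Lemma wcoef_row_eq0 (x z : xvar g) a d u0 : is_inl x = is_inl z ->
  (forall u, wcoef p (wtr (x :: a) ++ u ++ x :: a) = 0) ->
  wcoef p (wtr (x :: a) ++ u0 ++ z :: d) = 0.
Proof.
set A := x :: a; set B := z :: d => xz A0.
have [u0D|Du0] := leqP (size u0) D; last first.
  by apply: (wcoef_size pD); rewrite !size_cat addnCA (leq_trans Du0) // leq_addr.
have [n [X [v [n0 GX Kv]]]] := nc_open_interpolation D G_open.
have [K Ku0] := Kv 1%N (fun w => const_mx (w == u0)%:R).
(* Pairing w(X) v with [u] detects [w = u0] among the words of length at most D. *)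
pose u := K^T.
have uv w : (size w <= D)%N -> (u^T *m wev (xval X) w *m v) 0 0 = (w == u0)%:R.
  by move=> wD; rewrite trmxK -mulmxA Ku0 // mxE.
have vu w : (size w <= D)%N -> (v^T *m wev (xval X) w *m u) 0 0 = (w == wtr u0)%:R.
  have trE (S : 'M[R]_1) : S 0 0 = S^T 0 0 by rewrite mxE.
  move=> wD; rewrite trE !trmx_mul (trmxK v) mulmxA -wev_wtr uv ?size_wtr //.
  by rewrite -[in RHS](inj_eq (inv_inj (@wtrK g))) wtrK.
have bilE c1 e1 c2 e2 M : ((c1 *: u + e1 *: v)^T *m M *m (c2 *: u + e2 *: v)) 0 0 =
    c1 * c2 * (u^T *m M *m u) 0 0 + c1 * e2 * (u^T *m M *m v) 0 0
    + e1 * c2 * (v^T *m M *m u) 0 0 + e1 * e2 * (v^T *m M *m v) 0 0.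
  have -> : (c1 *: u + e1 *: v)^T = c1 *: u^T + e1 *: v^T by rewrite linearD !linearZ.
  rewrite !mulmxDl !mulmxDr -!scalemxAl -!scalemxAr !mxE /=.
  ring.
pose C := \sum_(w <- msupp p) p@_w * \sum_(t <- cuts w) \sum_(r <- cocuts t.2)
   ((wtr t.1 == B)%:R * (r.2 == B)%:R * (v^T *m wev (xval X) r.1 *m v) 0 0).
(* An affine function of s that is nonnegative everywhere has slope 0: otherwise the value of s
   chosen below would give -1. *)
suff pos s : 0 <= s * (wcoef p (wtr A ++ u0 ++ B) *+ 2) + C.
  apply: contrapT => /eqP c0; have := pos (- (C + 1) / (wcoef p (wtr A ++ u0 ++ B) *+ 2)).
  by rewrite divfK ?mulrn_eq0 //; lra.
(* The test is made at Y = X. The terms in s^2 carry coefficients that vanish by [A0], the cross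
   terms give the slope, and [C] collects the terms without s. *)
pose y w := (s * (w == A)%:R) *: u + (w == B)%:R *: v.
have yb c w : is_inl c != is_inl x -> y (c :: w) = 0.
  move=> cx; rewrite /y !eqseq_cons.
  have /negPf-> : c != x by apply: contraNneq cx => ->.
  have /negPf-> : c != z by rewrite xz in cx; apply: contraNneq cx => ->.
  by rewrite /= mulr0 !scale0r addr0.
have [tau [tau0 tauE _ _]] := plush_test G_open p_plush D n0 GX yb.
suff <- : \sum_(w <- msupp p) p@_w * tau w = s * (wcoef p (wtr A ++ u0 ++ B) *+ 2) + C by [].
(* By symmetry of p, A^T u0 B and its transpose have the same coefficient, whence the factor 2. *)
rewrite mulr2n -{2}(wcoef_wtr p_sym) !wtr_cat wtrK -catA mulrDr.
rewrite -!(sum_wcoef p) !mulr_sumr /C -!big_split /= big_seq [RHS]big_seq.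
apply: eq_bigr => w wp; rewrite tauE ?pD //.
have wtrN c' (w' : seq (xvar g)) : wtr (c' :: w') != [::].
  by rewrite -size_eq0 size_wtr.
rewrite -(@sum_cuts2 _ R w (wtr A) u0 B) ?wtrN //.
rewrite -(@sum_cuts2 _ R w (wtr B) (wtr u0) A) ?wtrN //.
rewrite !mulr_sumr -!big_split /= big_seq [RHS]big_seq; apply: eq_bigr => t.
case/mem_cuts=> _ wt; rewrite zvecE mulmx_sumr summxE !mulr_sumr -!big_split /=.
rewrite big_seq [RHS]big_seq; apply: eq_bigr => r /mem_cocuts[_ tr].
have rD : (size r.1 <= D)%N.
  by rewrite (leq_trans _ (pD wp)) // wt tr !size_cat addnCA leq_addr.
rewrite mulmxA bilE uv // vu // -!mulnb !natrM !(can2_eq (@wtrK g) (@wtrK g)).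
have [tA|_] := eqVneq t.1 (wtr A); have [rA|_] := eqVneq r.2 A; rewrite /=; try ring.
have -> : p@_w = 0 by rewrite -(A0 r.1) /wcoef -tA -[in RHS]rA -tr -wt fmK.
by rewrite !mul0r !mulr0 !addr0.
Qed.

(* If x a contains a letter l of the other type, then in any word
   (x a)^T u (x a) the letter x of the right factor x a and the l following it
   exhibit a longer word of the same kind, of the other type, on the left. *)
Lemma wcoef_mixed_eq0 (x z : xvar g) a u d : is_inl x = is_inl z ->
  has (fun c => is_inl c != is_inl x) a -> wcoef p (wtr (x :: a) ++ u ++ z :: d) = 0.
Proof.
(* [k] bounds [D - size a]; when it is 0, the word [x :: a] alone is longer than D. *)
have [k Dk] : exists k, (D - size a <= k)%N by exists (D - size a)%N.
elim: k x z a u d Dk => [|k IHk] x z a u d Dk xz xa.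
  by apply: (wcoef_size pD); rewrite size_cat size_wtr /=; lia.
apply: wcoef_row_eq0 => // {z d xz} {}u.
have /hasP[l la lx] := xa; case/splitPr: la Dk xa => a1 a2 Dk _.
have := IHk (xvar_tr x) l (wtr u ++ x :: a1 ++ l :: a2) a1 a2.
rewrite -[wtr (xvar_tr x :: _)]/(wtr ([:: xvar_tr x] ++ _)) !wtr_cat !wtrK.
rewrite wtr1 xvar_trK -!catA /=; apply.
- by move: Dk; rewrite !size_cat /= !size_cat /= size_wtr; lia.
- by rewrite xvar_tr_type; case: (is_inl x) (is_inl l) lx => [] [].
by rewrite has_cat /= xvar_tr_type; case: (is_inl x); rewrite ?orbT.
Qed.

Lemma first_change (w : seq (xvar g)) : (exists b, pure b w) \/
  exists u z d, [/\ u != [::], pure (~~ is_inl z) u & w = u ++ z :: d].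
Proof.
elim: w => [|a w IHw]; first by left; exists true.
case: w IHw => [_|c w IHw]; first by left; exists (is_inl a); rewrite /= eqxx.
have [ac|ac] := eqVneq (is_inl a) (is_inl c); last first.
  right; exists [:: a], c, w; split=> //=; rewrite andbT.
  by case: (is_inl a) (is_inl c) ac => [] [].
case: IHw => [[b /= /andP[cb wb]]|[u [z [d [uN pu e]]]]].
  by left; exists b; rewrite /= ac cb wb.
right; exists (a :: u), z, d; split; rewrite ?e //=; apply/andP; split => //.
case: u uN pu e => [|c' u] //= _ /andP[c'z _] [cc' _].
by rewrite ac cc'.
Qed.

(** The word is cut at its first change of type. Were the right factor not pure, the transposed word
    would fall under [wcoef_mixed_eq0] with an empty middle factor. *)
Lemma wcoef_neq0_cases w : wcoef p w != 0 -> (exists b, pure b w) \/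
  exists b c d, [/\ c != [::] /\ d != [::], pure b c, pure b d & w = wtr c ++ d].
Proof.
move=> w0; case: (first_change w) => [|[u [z [d [uN pu e]]]]]; first by left.
right; exists (is_inl z), (wtr u), (z :: d); rewrite wtrK; split => //.
- by split => //; rewrite -size_eq0 size_wtr size_eq0.
- by rewrite pure_wtr.
rewrite /= eqxx /=; apply: contraNT w0; rewrite -has_predC => dz.
rewrite e -(wcoef_wtr p_sym) wtr_cat.
case eu: (wtr u) => [|c u'].
  by move: uN; rewrite -size_eq0 -size_wtr eu.
rewrite -[wtr _ ++ _]/(wtr _ ++ [::] ++ _) wcoef_mixed_eq0 //.
have : pure (is_inl z) (wtr u) by rewrite pure_wtr.
by rewrite eu /= => /andP[/eqP ->].
Qed.

End Vanishing.

(** * The LDL decomposition *)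

Section LDL.
Variable R : realType.

Lemma psd_block_form n (a s : R) (B : 'cV[R]_n) (C : 'M[R]_n) (v : 'cV[R]_n) :
  ((col_mx s%:M v)^T *m block_mx a%:M B^T B C *m col_mx s%:M v) 0 0 =
  a * s ^+ 2 + s * (B^T *m v) 0 0 *+ 2 + (v^T *m C *m v) 0 0.
Proof.
rewrite tr_col_mx mul_row_block mul_row_col tr_scalar_mx !mulmxDl.
have -> : v^T *m B = (B^T *m v)^T by rewrite trmx_mul trmxK.
rewrite -[s%:M *m B^T *m v]mulmxA !mul_scalar_mx.
move: (B^T *m v) (v^T *m C *m v) => x z.
rewrite !mul_mx_scalar !mxE /=; ring.
Qed.

(** Symmetric Gaussian elimination by Schur complements, with pivots allowed to vanish. *)
Lemma psd_LDL N (P : 'M[R]_N) : psd P ->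
  exists (L : 'M[R]_N) (d : 'rV[R]_N),
    [/\ is_trig_mx L, forall i, L i i = 1, forall i, 0 <= d 0 i
      & P = L *m diag_mx d *m L^T].
Proof.
elim: N P => [|n IHn] P [Psym Ppos].
  exists 1%:M, 0; split=> [|[]//|[]//|]; first exact: scalar_mx_is_trig.
  by apply/matrixP => -[].
have [a [B [C [PE Csym]]]] : exists (a : R) (B : 'cV[R]_n) (C : 'M[R]_n),
    P = block_mx a%:M B^T B C :> 'M_(1 + n) /\ C^T = C.
  exists (P 0 0), (@dlsubmx R 1 n 1 n P), (@drsubmx R 1 n 1 n P); split.
    rewrite -[LHS](@submxK R 1 n 1 n); congr (block_mx _ _ _ _).
      by apply/matrixP => i j; rewrite !ord1 !mxE mulr1n; congr (P _ _); apply: val_inj.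
    by rewrite trmx_dlsub Psym.
  by rewrite trmx_drsub Psym.
have form (s : R) (v : 'cV_n) :
    0 <= a * s ^+ 2 + s * (B^T *m v) 0 0 *+ 2 + (v^T *m C *m v) 0 0.
  by have := psd_block_form a s B C v; rewrite -PE => <-; apply: Ppos.
have a0 : 0 <= a.
  by have := form 1 0; rewrite !mulmx0 !mxE expr1n; lra.
have [b aB] : exists b, B = a *: b.
  (* For a = 0 the inverse is 0 by convention, so B = 0 is to be shown: the form is then affine in
     s, and a nonzero entry of B would let it take the value -1. *)
  exists (a^-1 *: B).
  have [aN0|] := eqVneq a 0; last by move=> aN0; rewrite scalerA divff // scale1r.
  rewrite aN0 scale0r; apply/colP => i; rewrite mxE; apply: contrapT => /eqP Bi.
  pose v : 'cV[R]_n := delta_mx i 0; set c : R := (v^T *m C *m v) 0 0.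
  have := form (- (c + 1) / (B i 0 *+ 2)) v; rewrite aN0 -/c.
  have -> : (B^T *m v) 0 0 = B i 0 by rewrite /v -colE !mxE.
  by rewrite -mulrnAr divfK ?mulrn_eq0 //; lra.
have [|L [d [Ltrig L1 d0 CE]]] := IHn (C - a *: (b *m b^T)).
  split=> [|v]; first by rewrite linearB linearZ /= trmx_mul trmxK Csym.
  have bv : (v^T *m (a *: (b *m b^T)) *m v) 0 0 = a * (b^T *m v) 0 0 ^+ 2.
    rewrite -scalemxAr -scalemxAl (mulmxA v^T b) -(mulmxA (v^T *m b)) mxE.
    have -> : v^T *m b = (b^T *m v)^T by rewrite trmx_mul trmxK.
    by move: (b^T *m v) => x; rewrite mxE big_ord1 mxE.
  rewrite mulmxBr mulmxBl mxE [(- _ : 'M_1) _ _]mxE bv.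
  (* This s minimizes the form for fixed v; the minimum is the form of the Schur complement. *)
  have := form (- (b^T *m v) 0 0) v; rewrite aB.
  have -> : ((a *: b)^T *m v) 0 0 = a * (b^T *m v) 0 0.
    by rewrite linearZ /= -scalemxAl mxE.
  by move: ((b^T *m v) 0 0) => z; nra.
pose M : 'M[R]_(1 + n) := block_mx 1%:M 0 b L.
pose e : 'rV[R]_(1 + n) := row_mx a%:M d.
exists M, e; split.
- have -> : is_trig_mx M =
      [&& 0 == 0 :> 'M[R]_(1, n), is_trig_mx (1%:M : 'M[R]_1) & is_trig_mx L].
    exact: (@is_trig_block_mx R 1 n 1 n).
  by rewrite eqxx scalar_mx_is_trig.
- move=> i; rewrite -[i](@splitK 1 n); case: (split _) => j /=.
    by rewrite (block_mxEul (1%:M : 'M_1) 0 b L) !ord1 mxE.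
  by rewrite (block_mxEdr (1%:M : 'M_1) 0 b L).
- move=> i; rewrite -[i](@splitK 1 n); case: (split _) => j /=.
    by rewrite (row_mxEl (a%:M : 'rV_1) d) !ord1 mxE.
  by rewrite (row_mxEr (a%:M : 'rV_1) d).
suff -> : M *m diag_mx e *m M^T = block_mx a%:M B^T B C by [].
rewrite /e diag_mx_row tr_block_mx !mulmx_block !mulmx0 !mul0mx !add0r !addr0.
rewrite !trmx1 !trmx0 mul1mx !mulmx1 !mulmx0 !addr0.
have -> : diag_mx (a%:M : 'rV_1) = a%:M by apply/matrixP => i j; rewrite !ord1 !mxE.
rewrite mul_scalar_mx mul_mx_scalar -scalemxAl -CE aB; congr (block_mx _ _ _ _).
- by rewrite mul0mx addr0 linearZ.
- by rewrite addrC subrK.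
Qed.

End LDL.

(** * The Gram matrix *)

Section PureWords.
Variables (g D : nat).
Notation word := (seq (xvar g)).

(** These words index the border vector. Decreasing length makes [suffix_mx] lower triangular; the
    empty word has derivative 0. *)
Definition pure_words : seq word :=
  sort (fun u w => size w <= size u)%N
    [seq w <- map val (enum {: D.-bseq (xvar g)}) |
      (w != [::]) && (pure true w || pure false w)].

Lemma mem_pure_words w : (w \in pure_words) =
  [&& (size w <= D)%N, w != [::] & pure true w || pure false w].
Proof.
rewrite mem_sort mem_filter andbC; congr (_ && _).
apply/mapP/idP => [[u _ ->]|wD]; first exact: size_bseq.
by exists (Bseq wD) => //; rewrite mem_enum.
Qed.

Lemma pure_words_uniq : uniq pure_words.
Proof. by rewrite sort_uniq filter_uniq // map_inj_uniq ?enum_uniq //; exact: val_inj. Qed.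

Definition pword (i : 'I_(size pure_words)) : word := nth [::] pure_words i.

Lemma pword_inj : injective pword.
Proof.
by move=> i j /eqP; rewrite nth_uniq ?pure_words_uniq // => /eqP /val_inj.
Qed.

Lemma pword_mem i : pword i \in pure_words.
Proof. exact: mem_nth. Qed.

Lemma pword_surj w : w \in pure_words -> exists i, pword i = w.
Proof.
rewrite -index_mem => wi; exists (Ordinal wi); rewrite /pword /= nth_index //.
by rewrite -index_mem.
Qed.

Lemma pword_size i : (size (pword i) <= D)%N.
Proof. by have := pword_mem i; rewrite mem_pure_words => /and3P[]. Qed.

Lemma pword_sorted (i j : 'I_(size pure_words)) :
  (i < j)%N -> (size (pword j) <= size (pword i))%N.
Proof.
move=> ij.
have tr : transitive (fun u w : word => size w <= size u)%N.
  by move=> u w z wu zw; exact: leq_trans zw wu.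
have tot : total (fun u w : word => size w <= size u)%N by move=> u w; exact: leq_total.
have := @sorted_ltn_nth _ _ tr [::] pure_words (sort_sorted tot _) i j.
by rewrite !inE !ltn_ord; apply.
Qed.

Definition wtype (w : word) := if w is a :: _ then is_inl a else true.

Lemma pword_pure i : pure (wtype (pword i)) (pword i).
Proof.
have := pword_mem i; rewrite mem_pure_words => /and3P[_].
by case: (pword i) => //= a w _ /orP[] /andP[/eqP -> ->].
Qed.

Lemma pword_neq0 i : pword i != [::].
Proof. by have := pword_mem i; rewrite mem_pure_words => /and3P[]. Qed.

Lemma pure_wtype b w : pure b w -> w != [::] -> wtype w = b.
Proof. by case: w => //= a w /andP[/eqP]. Qed.

(* The left factor consists of the letters of type ~~ b, and b is not the type
   of the first letter. *)
Lemma wtr_cat_pure_inj b b' (c d c' d' : word) : c != [::] -> c' != [::] ->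
  pure b c -> pure b d -> pure b' c' -> pure b' d' ->
  wtr c ++ d = wtr c' ++ d' -> c = c' /\ d = d'.
Proof.
move=> c0 c'0 pc pd pc' pd' e.
have head0 w x y b0 : w != [::] -> pure b0 w -> wtr w ++ x = y -> wtype y = ~~ b0.
  move=> w0 pw <-; have : pure (~~ b0) (wtr w) by rewrite pure_wtr negbK.
  have : wtr w != [::] by rewrite -size_eq0 size_wtr size_eq0.
  by case: (wtr w) => //= a u _ /andP[/eqP].
have bb' : b = b'.
  apply: (can_inj negbK); rewrite -(head0 _ _ _ _ c0 pc e).
  exact: (head0 _ _ _ _ c'0 pc' (erefl _)).
subst b'.
have filt (u w : word) : pure b u -> pure b w ->
    [seq a <- wtr u ++ w | is_inl a == ~~ b] = wtr u.
  move=> pu pw; rewrite filter_cat (all_filterP _); last first.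
    by rewrite -/(pure _ _) pure_wtr negbK.
  rewrite (_ : [seq a <- w | is_inl a == ~~ b] = [::]) ?cats0 //; apply/eqP.
  rewrite -(negbK (_ == _)) -has_filter.
  by apply/hasPn => a /(allP pw) /eqP ->; case: (b).
have := congr1 (seq.filter (fun a => is_inl a == ~~ b)) e.
rewrite !filt // => /(can_inj (@wtrK g)) cc'.
by move: e; rewrite cc' => /(congr1 (drop (size (wtr c')))); rewrite !drop_size_cat.
Qed.

End PureWords.

Section Gram.
Variables (R : realType) (g : nat) (p : ncpoly R (xvar g)) (G : ncset R g).
Hypotheses (p_sym : nc_symmetric p) (G_open : nc_open_set G) (p_plush : nc_plush G p).
Variable D : nat.
Hypothesis pD : forall w, w \in msupp p -> (size w <= D)%N.
Notation N := (size (pure_words g D)).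
Notation e := (@pword g D).

(** When the types differ, [wtr (e i) ++ e j] is a pure word, on which the hessian vanishes; the
    entry is set to 0. *)
Definition gram : 'M[R]_N := \matrix_(i, j)
  if wtype (e i) == wtype (e j) then wcoef p (wtr (e i) ++ e j) else 0.

(** A word of the support is pure, where [F] vanishes, or is [wtr c ++ d] for a unique pair of
    indexing words of equal type. [F] will be [tau] and then [mark2]. *)
Lemma sum_gram (V : lmodType R) (F : seq (xvar g) -> V) :
  (forall b w, (size w <= D)%N -> pure b w -> F w = 0) ->
  \sum_(w <- msupp p) p@_w *: F w = \sum_i \sum_j gram i j *: F (wtr (e i) ++ e j).
Proof.
move=> F0.
have -> : \sum_i \sum_j gram i j *: F (wtr (e i) ++ e j) =
    \sum_(w <- msupp p) p@_w *: (\sum_i \sum_j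
      ((wtype (e i) == wtype (e j)) && (w == wtr (e i) ++ e j :> seq _))%:R *: F w).
  under [RHS]eq_bigr => w _ do rewrite scaler_sumr.
  rewrite [RHS]exchange_big; apply: eq_bigr => i _.
  under [RHS]eq_bigr => w _ do rewrite scaler_sumr.
  rewrite [RHS]exchange_big; apply: eq_bigr => j _; rewrite mxE.
  case: eqP => _; last by rewrite scale0r big1 // => w _; rewrite scale0r scaler0.
  rewrite -sum_wcoef scaler_suml; apply: eq_bigr => w _ /=; rewrite -scalerA.
  by case: eqP => [->|]; rewrite ?scale0r.
rewrite big_seq [RHS]big_seq; apply: eq_bigr => w wp; congr (_ *: _).
have w0 : wcoef p w != 0 by rewrite /wcoef fmK mcoeff_neq0.
have [[b pw]|[b [c [d [[c0 d0] pc pd ew]]]]] := wcoef_neq0_cases p_sym G_open p_plush pD w0.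
  rewrite (F0 b) ?pD // big1 // => i _; rewrite big1 // => j _; exact: scaler0.
have wD : (size w <= D)%N by exact: pD.
have [i ei] : exists i, e i = c.
  apply: pword_surj; rewrite mem_pure_words c0 /= (leq_trans _ wD) /=; last first.
    by rewrite ew size_cat size_wtr leq_addr.
  by case: (b) pc => ->; rewrite ?orbT.
have [j ej] : exists j, e j = d.
  apply: pword_surj; rewrite mem_pure_words d0 /= (leq_trans _ wD) /=; last first.
    by rewrite ew size_cat size_wtr leq_addl.
  by case: (b) pd => ->; rewrite ?orbT.
have uniq_ij i' j' : wtype (e i') = wtype (e j') -> w = wtr (e i') ++ e j' :> seq _ ->
    i' = i /\ j' = j.
  move=> tij; rewrite ew => /esym ew'.
  have pj : pure (wtype (e i')) (e j') by rewrite tij pword_pure.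
  have [ci dj] := wtr_cat_pure_inj (pword_neq0 i') c0 (pword_pure i') pj pc pd ew'.
  by split; apply: pword_inj; rewrite ?ci ?dj.
rewrite (bigD1 i) //= (bigD1 j) //= ei ej (pure_wtype pc) // (pure_wtype pd) //.
rewrite ew !eqxx scale1r -ew !big1 ?addr0 // => [i' ii'|j' jj'].
  rewrite big1 // => j' _; case: andP => [[/eqP tij /eqP wij]|_]; last by rewrite scale0r.
  by have [e1] := uniq_ij _ _ tij wij; rewrite e1 eqxx in ii'.
case: andP => [[/eqP tij /eqP wij]|_]; last by rewrite scale0r.
have [||_ e2] := uniq_ij i j'; rewrite ?ei ?(pure_wtype pc) //.
by rewrite e2 eqxx in jj'.
Qed.

Lemma gram_type_ge0 (b : bool) (lam : seq (xvar g) -> R) : lam [::] = 0 ->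
  0 <= \sum_i \sum_j gram i j *
    ((wtype (e i) == b) && (wtype (e j) == b))%:R * (lam (e i) * lam (e j)).
Proof.
move=> lam0; have [[m m0 [Y GY]] _ _] := G_open.
pose x : 'cV[R]_m := delta_mx (Ordinal m0) 0.
have xx : (x^T *m x) 0 0 = 1 by rewrite trmx_delta mul_delta_mx mxE !eqxx.
(* Solves the recursion of [zvec] so that [zvec] takes the value [lam w *: x] on pure words of type
   [b]; [lam0] is the initial condition. *)
pose y w := if w is a :: d then
  (if pure b w then lam w *: x - lam d *: (xval Y a *m x) else 0) else 0.
have yb a w : is_inl a != b -> y (a :: w) = 0 by move=> ab; rewrite /y /= (negPf ab).
have zE w : pure b w -> zvec Y y w = lam w *: x.
  elim: w => [|a w IHw]; first by rewrite lam0 scale0r.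
  move=> pw; have -> : zvec Y y (a :: w) = xval Y a *m zvec Y y w + y (a :: w) by [].
  rewrite {2}/y pw IHw; last by case/andP: pw.
  by rewrite -scalemxAr addrC subrK.
have [tau [tau0 _ tau1 tau2]] := plush_test G_open p_plush D m0 GY yb.
move: tau0; rewrite (sum_gram (V := R^o) (F := tau)) => [|b' w wD pw].
  congr (0 <= _); apply: eq_bigr => i _; apply: eq_bigr => j _.
  rewrite -[_ *: _]/(_ * _) -mulrA mxE; case: eqP => tij; last by rewrite !mul0r.
  congr (_ * _); have pi := pword_pure i; have pj := pword_pure j; rewrite -tij in pj *.
  rewrite andbb; case: eqP => [tb|/eqP tb]; last first.
    have tb' : wtype (e i) = ~~ b by case: (wtype _) (b) tb => [] [].
    by rewrite tau2 ?mul0r // -tb'.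
  rewrite tb in pi pj; rewrite tau1 ?pword_size // !zE // mul1r.
  by rewrite [(_ *: x)^T]linearZ /= -scalemxAl -scalemxAr scalerA mxE xx mulr1.
(* A pure word is a product with empty left factor, on which [zvec] vanishes. *)
rewrite -[w](@cat0s _ w) -[[::]]/(wtr [::]).
have [bb'|bb'] := eqVneq b' b; last first.
  by rewrite tau2 //; case: (b') (b) bb' pw => [] [].
rewrite bb' in pw; by rewrite tau1 //= trmx0 mul0mx mxE.
Qed.

(** The matrix has one diagonal block for each type, and [gram_type_ge0] handles each. *)
Lemma gram_psd : psd gram.
Proof.
split=> [|v].
  apply/matrixP => i j; rewrite !mxE eq_sym; case: eqP => // _.
  by rewrite -(wcoef_wtr p_sym) wtr_cat wtrK.
pose lam w := \sum_i (w == e i)%:R * v i 0.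
have lamE i : lam (e i) = v i 0.
  rewrite /lam (bigD1 i) //= eqxx mul1r big1 ?addr0 // => j ji.
  by rewrite (inj_eq (@pword_inj g D)) eq_sym (negPf ji) mul0r.
have lam0 : lam [::] = 0.
  by rewrite /lam big1 // => i _; rewrite eq_sym (negPf (pword_neq0 i)) mul0r.
have := addr_ge0 (gram_type_ge0 true lam0) (gram_type_ge0 false lam0).
rewrite -big_split /= mxE; congr (0 <= _).
under [RHS]eq_bigr => j _ do rewrite mxE mulr_suml.
rewrite exchange_big /=; apply: eq_bigr => i _.
rewrite -big_split /=; apply: eq_bigr => j _.
rewrite !lamE !mxE; case: eqP => [->|_]; last by rewrite !(mulr0, mul0r) addr0.
by case: (wtype (e j)) => /=; ring.
Qed.

End Gram.

(** * The factorization *)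

Section UnitTriangular.
Variables (S : pzRingType) (n : nat).

Lemma trigmx_mul_entry (A B : 'M[S]_n) (i j : 'I_n) :
  is_trig_mx A -> is_trig_mx B -> (i <= j)%N ->
  (A *m B) i j = if i == j then A i i * B i i else 0.
Proof.
move=> /is_trig_mxP At /is_trig_mxP Bt ij.
have kN (k : 'I_n) : k != i -> A i k * B k j = 0.
  move=> ki; have [ik|ik] := ltnP i k; first by rewrite At // mul0r.
  rewrite Bt ?mulr0 //; apply: leq_trans ij; rewrite ltn_neqAle ik andbT.
  by apply: contraNneq ki => /val_inj ->.
rewrite mxE (bigD1 i) //= big1 ?addr0 => [|k /kN //].
case: eqP => [<- //|/eqP ij']; rewrite Bt ?mulr0 // ltn_neqAle ij andbT.
by apply: contraNneq ij' => /val_inj ->.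
Qed.

Lemma mulmx_regroup k l (V : 'M[S]_(k, n)) (A B C B' A' : 'M[S]_n) (W : 'M[S]_(n, l)) :
  V *m (A *m B) *m C *m (B' *m A') *m W = V *m A *m (B *m C *m B') *m (A' *m W).
Proof. by rewrite !mulmxA. Qed.

End UnitTriangular.

Lemma nc_trK (R : realType) (A : choiceType) (s : A -> A) :
  involutive s -> involutive (@nc_tr R A s).
Proof.
move=> sK; elim/malg_ind => [|p q IHp IHq|c w]; first by rewrite !nc_tr0.
  by rewrite (nc_trD s p q) (nc_trD s (nc_tr s p) (nc_tr s q)); congr (_ + _).
rewrite !nc_trU; congr << _ *g _ >>.
by rewrite /word_tr /= map_rev revK mapK // fmK.
Qed.

Lemma mulr_malgC (R : comNzRingType) (K : monomType) (x : {malg R[K]}) c :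
  x * c%:MP = c *: x.
Proof.
elim/malg_ind: x => [|p q IHp IHq|d w]; first by rewrite mul0r scaler0.
  by rewrite mulrDl IHp IHq scalerDr.
by rewrite malgUM mulm1 mulrC [in RHS]malgUZ scalerA -malgUZ.
Qed.

Section MarkCocuts.
Variables (S : pzRingType) (g : nat) (x h : xvar g -> S).

Definition hhead (w : seq (xvar g)) : S :=
  if w is a :: w' then h a * mon x w' else 0.

(** Terms are grouped by the prefix before the replaced letter; the rest is a border monomial. *)
Lemma mark_cocuts w :
  mark x h predT w = \sum_(t <- cocuts w) mon x t.1 * hhead t.2.
Proof.
elim: w => [|a w IHw] /=; first by rewrite big_nil.
rewrite big_cons big_map /= mon_nil mul1r addrC IHw mulr_sumr; congr (_ + _).
by apply: eq_bigr => t _; rewrite mon_cons mulrA.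
Qed.

End MarkCocuts.

Section Factorization.
Variables (R : realType) (g D : nat).
Notation N := (size (pure_words g D)).
Notation e := (@pword g D).
Notation S := (ncpoly R (xhvar g)).
Notation tr := (nc_tr (@xhvar_tr g)).
Notation mxtr := (ncmx_tr (@xhvar_tr g)).
Notation mxC := (map_mx (fun c : R => c%:MP)).

Lemma mon_xlet w : mon (@xlet R g) w = << word_incl (FMonom w) >>.
Proof.
elim: w => [|a w IHw]; first by rewrite mon_nil /word_incl /= -fmoneE.
by rewrite mon_cons IHw malgUM mulr1 /mmul /= fmmulE fmU.
Qed.

Definition border : 'cV[S]_N := \col_i hhead (@xlet R g) (@hlet R g) (e i).

Lemma border_vectorP : border_vector border.
Proof.
move=> i; rewrite mxE; have := pword_neq0 i.
case: (e i) => [//|[] j w] _; exists j, (FMonom w); rewrite /= mon_xlet; first by left.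
by right.
Qed.

Lemma xhvar_trK : involutive (@xhvar_tr g).
Proof. by case=> a /=; rewrite xvar_trK. Qed.

(** Prefixes enter transposed because it is the transpose of this matrix that multiplies the border
    vector. *)
Definition suffix_mx : 'M[ncpoly R (xvar g)]_N :=
  \matrix_(i, j) \sum_(t <- cocuts (e j) | t.2 == e i) << FMonom (wtr t.1) >>.

(** A suffix is at most as long as its word, and equal to it when the lengths agree, while longer
    words come first. *)
Lemma suffix_mx_trig : is_trig_mx suffix_mx.
Proof.
apply/is_trig_mxP => i j ij; rewrite mxE big_seq_cond big1 // => t.
case/andP=> /mem_cocuts[_ et] /eqP ti.
have := pword_sorted ij; rewrite et size_cat -ti -[leqRHS]add0n leq_add2r leqn0.
move/nilP => t1.
move: et; rewrite t1 ti /= => /pword_inj ji; by rewrite ji ltnn in ij.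
Qed.

Lemma suffix_mx_diag i : suffix_mx i i = 1.
Proof.
rewrite mxE; case ei: (e i) => [|a w]; first by have := pword_neq0 i; rewrite ei.
rewrite /= big_cons /= eqxx big_map big_seq_cond big1 ?addr0.
  by rewrite /wtr /= -fmoneE.
move=> t /andP[/mem_cocuts[_ ew] /eqP /= et].
by have := leq_addl (size t.1) (size t.2); rewrite -size_cat -ew et /= ltnn.
Qed.

Lemma tr_incl_suffix i j : tr (nc_incl (suffix_mx i j)) =
  \sum_(t <- cocuts (e j) | t.2 == e i) mon (@xlet R g) t.1.
Proof.
rewrite mxE !(big_mkcond (fun t => t.2 == _)) nc_incl_sum nc_tr_sum.
apply: eq_bigr => t _; case: ifP => _; last by rewrite nc_incl0 nc_tr0.
rewrite nc_inclU nc_trU mon_xlet; congr << _ *g _ >>.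
rewrite /word_tr /word_incl /= /wtr map_rev map_rev revK -!map_comp.
by congr FMonom; apply: eq_map => -[].
Qed.

Lemma suffix_border : mxtr (map_mx (@nc_incl R g) suffix_mx) *m border =
  \col_i mark (@xlet R g) (@hlet R g) predT (e i).
Proof.
apply/colP => j; rewrite !mxE mark_cocuts.
transitivity (\sum_i \sum_(t <- cocuts (e j))
   (if t.2 == e i then mon (@xlet R g) t.1 * hhead (@xlet R g) (@hlet R g) t.2 else 0)).
  apply: eq_bigr => i _; rewrite ncmx_trE mxE tr_incl_suffix mxE.
  rewrite big_mkcond mulr_suml; apply: eq_bigr => t _.
  by case: eqP => [->|_]; rewrite ?mul0r.
rewrite exchange_big big_seq [RHS]big_seq; apply: eq_bigr => t /mem_cocuts[tN et].
(* Nonempty suffixes of a pure word are pure, so each of them indexes a border entry. *)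
have [i ei] : exists i, e i = t.2.
  apply: pword_surj; rewrite mem_pure_words tN /=; apply/andP; split.
    by apply: leq_trans (pword_size j); rewrite et size_cat leq_addl.
  have := pword_pure j; rewrite {2}et /pure all_cat => /andP[_].
  by case: (wtype _) => ->; rewrite ?orbT.
rewrite (bigD1 i) //= big1 ?addr0 => [|k ki]; first by rewrite ei eqxx.
by rewrite -ei (inj_eq (@pword_inj g D)) eq_sym (negPf ki).
Qed.

Lemma nc_inclC c : nc_incl c%:MP = c%:MP :> S.
Proof. by rewrite nc_inclU; congr << _ *g _ >>; rewrite /word_incl fm1 /mone /= fmoneE. Qed.

Lemma ncmx_trK m n (M : 'M[S]_(m, n)) : mxtr (mxtr M) = M.
Proof. by apply/matrixP => i j; rewrite !ncmx_trE nc_trK //; exact: xhvar_trK. Qed.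

Lemma mxCM m n k (M : 'M[R]_(m, n)) (M' : 'M[R]_(n, k)) :
  mxC (M *m M') = mxC M *m mxC M' :> 'M[S]_(m, k).
Proof.
apply/matrixP => i j; rewrite !mxE raddf_sum; apply: eq_bigr => l _.
by rewrite !mxE -mpolyCM.
Qed.

Lemma mxC_congruence n (P L0 E : 'M[R]_n) : P = L0 *m E *m L0^T ->
  mxC P = mxC L0 *m mxC E *m mxC L0^T :> 'M[S]_n.
Proof.
move=> ->; apply: etrans (mxCM _ _) _; congr (_ *m _); exact: mxCM.
Qed.

Lemma congruence_factorization n (A : 'M[S]_n) (V : 'cV[S]_n) (P L0 E : 'M[R]_n) :
  P = L0 *m E *m L0^T ->
  mxtr V *m (A *m mxC L0) *m mxC E *m mxtr (A *m mxC L0) *m V =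
  mxtr (mxtr A *m V) *m mxC P *m (mxtr A *m V).
Proof.
move/mxC_congruence => ->.
rewrite (ncmx_trM _ A) (ncmx_trM _ (mxtr A)) (ncmx_trK A) ncmx_tr_const.
exact: mulmx_regroup.
Qed.

(** The suffix matrix expands derivatives in border monomials, and [L0] diagonalizes the constant
    form between them; L is their product. *)
Lemma gram_factorization (P L0 : 'M[R]_N) (d : 'rV[R]_N)
    (L' := map_mx (@nc_incl R g) (suffix_mx *m mxC L0))
    (r := fun i => mark (@xlet R g) (@hlet R g) predT (e i)) :
  P = L0 *m diag_mx d *m L0^T ->
  (mxtr border *m L' *m mxC (diag_mx d) *m mxtr L' *m border) 0 0 =
  \sum_i \sum_j P i j *: (tr (r i) * r j).
Proof.
move=> PE.
have -> : L' = map_mx (@nc_incl R g) suffix_mx *m mxC L0.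
  apply/matrixP => i j; rewrite !mxE nc_incl_sum; apply: eq_bigr => k _.
  by rewrite nc_inclM !mxE nc_inclC.
rewrite (congruence_factorization _ _ PE) suffix_border.
rewrite !mxE exchange_big; apply: eq_bigr => j _.
rewrite !mxE mulr_suml; apply: eq_bigr => i _.
by rewrite ncmx_trE !mxE mulr_malgC scalerAl.
Qed.

Lemma tr_mark w : tr (mark (@xlet R g) (@hlet R g) predT w) =
  mark (@xlet R g) (@hlet R g) predT (wtr w).
Proof.
have trvar a : tr (var R a) = var R (xhvar_tr a).
  by rewrite nc_trU /word_tr fmU /var fmuE.
apply: (mark_antimorph (t := tr)).
- exact: nc_tr0.
- by rewrite nc_trC.
- exact: nc_trD.
- exact: nc_trM.
- by move=> a; rewrite trvar.
- by move=> a; rewrite trvar.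
Qed.

End Factorization.

Theorem theorem1p2 (R : realType) (g : nat) (p : ncpoly R (xvar g))
    (G : ncset R g) (p_sym : nc_symmetric p) (G_open : nc_open_set G)
    (p_plush : nc_plush G p) :
  exists (N : nat) (V : 'cV[ncpoly R (xhvar g)]_N)
         (L : 'M[ncpoly R (xvar g)]_N) (d : 'rV[R]_N),
    let L' := map_mx (@nc_incl R g) L in
    let D := map_mx (fun c : R => c%:MP) (diag_mx d) in
    [/\ border_vector V,
        forall i, 0 <= d 0 i,
        unit_lower_triangular L
      & complex_hessian p =
          (ncmx_tr (@xhvar_tr g) V *m L' *m D *m ncmx_tr (@xhvar_tr g) L'
             *m V) 0 0].
Proof.
pose D := \max_(w <- msupp p) size (w : seq (xvar g)).
have pD w : w \in msupp p -> (size w <= D)%N.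
  by move=> wp; apply: (@leq_bigmax_seq _ _ _ (fun w : {fmonom (xvar g)} => size w)).
have [L0 [d [L0trig L0diag d0 PE]]] := psd_LDL (gram_psd p_sym G_open p_plush pD).
exists (size (pure_words g D)), (@border R g D),
  (suffix_mx R g D *m map_mx (fun c : R => c%:MP) L0), d.
have L0t : is_trig_mx (map_mx (fun c : R => c%:MP) L0 : 'M[ncpoly R (xvar g)]__).
  apply/is_trig_mxP => i j ij; rewrite mxE; move/is_trig_mxP: L0trig => -> //.
  exact: raddf0.
split.
- exact: border_vectorP.
- exact: d0.
- split.
    apply/is_trig_mxP => i j ij.
    rewrite trigmx_mul_entry ?suffix_mx_trig // 1?ltnW //.
    by case: eqP ij => [->|//]; rewrite ltnn.
  move=> i; rewrite trigmx_mul_entry ?suffix_mx_trig // eqxx suffix_mx_diag mxE.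
  by rewrite L0diag mul1r.
rewrite (gram_factorization PE) complex_hessianE.
rewrite (sum_gram p_sym G_open p_plush pD (F := mark2 (@xlet R g) (@hlet R g))).
  apply: eq_bigr => i _; apply: eq_bigr => j _; rewrite mxE.
  case: eqP => tij; last by rewrite !scale0r.
  congr (_ *: _); rewrite tr_mark; apply: (@mark2_cat _ _ _ _ (wtype (pword j))).
    by rewrite pure_wtr negbK -tij pword_pure.
  exact: pword_pure.
by move=> b w _; exact: mark2_pure.
Qed.
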